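(* Let $$f^*:=\inf_{\chi}\frac{\widetilde E_\infty(\chi)}{\int_{\mathbb R^3}\chi\,dx},\qquad \widetilde E_\infty(\chi):=\int_{\mathbb R^3}|\nabla\chi|\,dx+\frac1{8\pi}\int_{\mathbb R^3}\int_{\mathbb R^3}\frac{\chi(x)\chi(y)}{|x-y|}\,dx\,dy,$$ where the infimum is taken over all $\chi\in BV(\mathbb R^3;\{0,1\})$ with $\int_{\mathbb R^3}\chi\,dx>0$. Then $$f^*\ge\frac{3^{5/3}}{4}.$$
   Context: $BV(\mathbb R^3;\{0,1\})$ is the set of functions of bounded variation on $\mathbb R^3$ (in particular integrable) with values in $\{0,1\}$ a.e., i.e. characteristic functions of sets of finite measure and finite perimeter; $\int_{\mathbb R^3}|\nabla\chi|\,dx$ denotes the total variation of $\chi$. The quantity $f^*$ is the minimal energy per unit mass in (the dimensionless form of) Gamow's liquid drop model. *)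

(* Defs.v *)
From HB Require Import structures.
From mathcomp Require Import all_boot all_order all_algebra.
From mathcomp Require Import all_classical all_reals all_analysis.
Set Implicit Arguments.
Unset Strict Implicit.
Unset Printing Implicit Defensive.
Import Order.TTheory GRing.Theory Num.Theory.
Import numFieldNormedType.Exports.
Local Open Scope classical_set_scope.
Local Open Scope ring_scope.

(* The library's sigma-finite instance on product measures is not found by
   inference, so lebesgue2 and lebesgue3 are given one explicitly. *)
Lemma sigma_finite_product d1 d2 (T1 : measurableType d1)
    (T2 : measurableType d2) (R : realType)
    (m1 : {sigma_finite_measure set T1 -> \bar R})
    (m2 : {sigma_finite_measure set T2 -> \bar R}) :
  sigma_finite setT (m1 \x m2)%E.
Proof.
have /sigma_finiteP[F [TF ndF Foo]] := sigma_finiteT m1.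
have /sigma_finiteP[G [TG ndG Goo]] := sigma_finiteT m2.
exists (fun n => F n `*` G n).
  rewrite -setXTT TF TG predeqE => -[x y]; split.
    move=> [/= [n _ Fnx] [k _ Gky]]; exists (maxn n k) => //; split.
    - by move: x Fnx; exact/subsetPset/ndF/leq_maxl.
    - by move: y Gky; exact/subsetPset/ndG/leq_maxr.
  by move=> [n _ []/= ? ?]; split; exists n.
move=> k; have [? ?] := Foo k; have [? ?] := Goo k.
split; first exact: measurableX.
by rewrite product_measure1E// lte_mul_pinfty// ge0_fin_numE.
Qed.

Section LiquidDrop.
Variable R : realType.

(* The canonical norm of R * R * R is the maximum norm; enorm3 is the Euclidean
   one. *)
Definition dot3 (x y : R * R * R) : R :=
  x.1.1 * y.1.1 + x.1.2 * y.1.2 + x.2 * y.2.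

Definition enorm3 (x : R * R * R) : R := Num.sqrt (dot3 x x).

Definition lebesgue2 :
    set (measurableTypeR R * measurableTypeR R) -> \bar R :=
  (@lebesgue_measure R \x @lebesgue_measure R)%E.

HB.instance Definition _ := Measure.on lebesgue2.

HB.instance Definition _ := Measure_isSigmaFinite.Build _ _ _ lebesgue2
  (sigma_finite_product _ _).

Definition lebesgue3 :
    set (measurableTypeR R * measurableTypeR R * measurableTypeR R) -> \bar R :=
  (lebesgue2 \x @lebesgue_measure R)%E.

HB.instance Definition _ := Measure.on lebesgue3.

HB.instance Definition _ := Measure_isSigmaFinite.Build _ _ _ lebesgue3
  (sigma_finite_product _ _).

Definition e1 : R * R * R := (1, 0, 0).
Definition e2 : R * R * R := (0, 1, 0).
Definition e3 : R * R * R := (0, 0, 1).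

Definition div3 (phi : R * R * R -> R * R * R) (x : R * R * R) : R :=
  ('D_e1 phi x).1.1 + ('D_e2 phi x).1.2 + ('D_e3 phi x).2.

Definition C1_field (phi : R * R * R -> R * R * R) : Prop :=
  (forall x, differentiable phi x) /\
  (forall v, continuous (fun x => 'D_v phi x)).

Definition compactly_supported (phi : R * R * R -> R * R * R) : Prop :=
  compact (closure [set x | phi x != 0]).

(* The total variation of the distributional gradient of u, by duality:
   |Du|(R^3) = sup { int u div phi | phi in C^1_c(R^3; R^3), |phi| <= 1 }. *)
Definition total_variation3 (u : R * R * R -> R) : \bar R :=
  ereal_sup [set (\int[lebesgue3]_x (u x * div3 phi x)%:E)%E |
    phi in [set phi | [/\ C1_field phi, compactly_supported phi
                        & forall x, enorm3 (phi x) <= 1]]].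

Definition BV3 (u : R * R * R -> R) : Prop :=
  lebesgue3.-integrable setT (EFin \o u) /\ (total_variation3 u < +oo)%E.

Definition BV3_01 (chi : R * R * R -> R) : Prop :=
  BV3 chi /\ {ae lebesgue3, forall x, chi x = 0 \/ chi x = 1}.

Definition mass (chi : R * R * R -> R) : \bar R :=
  (\int[lebesgue3]_x (chi x)%:E)%E.

(* The kernel takes the value 0 on the diagonal x = y (as 0^-1 = 0), which is
   Lebesgue negligible. *)
Definition coulomb (chi : R * R * R -> R) : \bar R :=
  (\int[lebesgue3]_x \int[lebesgue3]_y
     (chi x * chi y / enorm3 (x - y))%:E)%E.

Definition energy (chi : R * R * R -> R) : \bar R :=
  (total_variation3 chi + ((8 * pi)^-1)%:E * coulomb chi)%E.

Definition fstar : \bar R :=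
  ereal_inf [set (energy chi / mass chi)%E |
    chi in [set chi | BV3_01 chi /\ (0 < mass chi)%E]].

End LiquidDrop.

(* Main.v *)
Require Import Defs.
From HB Require Import structures.
From mathcomp Require Import all_boot all_order all_algebra.
From mathcomp Require Import all_classical all_reals all_analysis.
From mathcomp Require Import measurable_realfun ring lra.
Set Implicit Arguments.
Unset Strict Implicit.
Unset Printing Implicit Defensive.
Import Order.TTheory GRing.Theory Num.Theory.
Import numFieldNormedType.Exports.
Local Open Scope classical_set_scope.
Local Open Scope ring_scope.

(** Write chi for the indicator of the set, m for its volume, P for its
    perimeter, k for the product bump
    k(z) = prod_i (15/16) max(0, 1 - z_i^2)^2, which has integral 1, and
    K_l(z) = l^3 k(l z).  Two estimates are played against each other.

    - Perimeter controls the mass lost by mollification ([mass_le]): for all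
      l > 0, m <= int int chi(x) chi(y) K_l(x - y) dy dx + (19/100) P / l.
    - The mollifier at scale l = 3/10 lies below the Coulomb kernel
      ([moll_le_coulomb]): (157/100) K_l(z) <= 1 / (8 pi |z|).

    Together they bound the energy below by
    P + (157/100) (m - (19/30) P) >= (157/100) m, and 157/100 is just above
    3^(5/3) / 4 ([target_constant_le]).

    The first estimate is a flow in the scale l.  With
    G_l(z) = l^2 k(l z) z one has d/dl K_l = div G_l, so for a fixed function
    psi the derivative of int chi (psi * K_l) is int chi div (psi * G_l): the
    pairing whose supremum defines the total variation.  It is therefore at
    most P times the maximal length of the field psi * G_l.  As G_l is odd,
    psi may be replaced by psi - 1/2 in that field; when 0 <= psi <= 1 its
    length is then at most half of int |v . G_l| for a unit vector v, and
    Young's inequality with the second moment 1/7 of the bump gives the bound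
    (19/100) / l^2 ([enorm3_field]).  Integrating from l to infinity leaves
    (19/100) P / l ([overlap_le]).  As l grows, psi * K_l tends to psi
    uniformly if psi is Lipschitz ([convol_moll_near]), and psi is finally
    taken close to chi in L^1 ([lipschitz_density]).

    The second estimate is elementary: max(0, 1 - t) <= exp(-t) turns
    |w| k(w) into a function of |w| alone. *)

(** * Bounded functions with Lipschitz differential *)

Section C11.
Context {R : realType}.
Implicit Types V W : normedModType R.

(** A function together with its differential, with explicit bounds that share
    one constant.  Each clause bounds a quantity that is linear in [f], so the
    class passes to averages of translates of [f], hence to convolutions with
    an integrable weight, and the quadratic remainder makes those convolutions
    Frechet differentiable. *)
Definition C11 V (f : V -> R) (df : V -> V -> R) : Prop :=
  (forall x, linear (df x : V -> R^o)) /\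
  exists2 C : R, 0 <= C & forall x y h : V,
   [/\ `|f x| <= C, `|df x h| <= C * `|h|, `|f x - f y| <= C * `|x - y|,
       `|df x h - df y h| <= C * `|x - y| * `|h|
     & `|f (x + h) - f x - df x h| <= C * `|h| ^+ 2].

(** Used for coordinate projections and for dilations. *)
Lemma C11_comp V W (L : V -> W) (f : W -> R) (df : W -> W -> R) (B : R) :
  linear L -> (forall x, `|L x| <= B * `|x|) ->
  C11 f df -> C11 (f \o L) (fun x h => df (L x) (L h)).
Proof.
move=> linL bL [lf [C C0 Cf]]; split.
  by move=> x a u v; rewrite linL lf.
have B0 : 0 <= Num.max 0 B by rewrite le_max lexx.
have bL' x : `|L x| <= Num.max 0 B * `|x|.
  by apply: (le_trans (bL x)); rewrite ler_wpM2r// le_max lexx orbT.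
move: (Num.max 0 B : R) B0 bL' => {bL}B B0 bL.
have LB u v : L (u - v) = L u - L v.
  by rewrite -[u]scale1r -scaleN1r addrC linL scale1r scaleN1r addrC.
have LD u v : L (u + v) = L u + L v.
  by rewrite -[u in LHS]scale1r linL scale1r.
exists (C * (1 + B) ^+ 2) => [|x y h]; first by rewrite mulr_ge0// exprn_ge0// addr_ge0.
have [c1 c2 c3 c4 c5] := Cf (L x) (L y) (L h).
have B1 : 1 <= (1 + B) ^+ 2 by rewrite expr2; nra.
have B2 : B <= (1 + B) ^+ 2 by rewrite expr2; nra.
have B3 : B ^+ 2 <= (1 + B) ^+ 2 by rewrite !expr2; nra.
split => /=.
- by apply: (le_trans c1); rewrite ler_peMr.
- apply: (le_trans c2); rewrite -mulrA ler_wpM2l//.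
  by apply: (le_trans (bL h)); rewrite ler_wpM2r.
- apply: (le_trans c3); rewrite -LB -mulrA ler_wpM2l//.
  by apply: (le_trans (bL (x - y))); rewrite ler_wpM2r.
- apply: (le_trans c4); rewrite -LB -(mulrA C (`|_|)) -(mulrA C ((1 + B) ^+ 2)) -(mulrA C).
  rewrite ler_wpM2l// -(mulrA ((1 + B) ^+ 2)).
  apply: (@le_trans _ _ ((B * `|x - y|) * (B * `|h|))).
    by apply: ler_pM => //; exact: bL.
  have -> : B * `|x - y| * (B * `|h|) = B ^+ 2 * (`|x - y| * `|h|) by ring.
  by rewrite ler_wpM2r ?mulr_ge0.
- rewrite LD; apply: (le_trans c5); rewrite -mulrA ler_wpM2l//.
  apply: (@le_trans _ _ ((B * `|h|) ^+ 2)).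
    by rewrite ler_sqr ?nnegrE ?mulr_ge0//; exact: bL.
  by rewrite exprMn ler_wpM2r// exprn_ge0.
Qed.

Lemma C11_mul V (f g : V -> R) df dg : C11 f df -> C11 g dg ->
  C11 (fun x => f x * g x) (fun x h => df x h * g x + f x * dg x h).
Proof.
move=> [lf [C C0 Cf]] [lg [D D0 Dg]]; split.
  move=> x a u v; rewrite lf lg /GRing.scale/=; ring.
exists (4 * C * D) => [|x y h]; first by rewrite !mulr_ge0.
have [c1 c2 c3 c4 c5] := Cf x y h.
have [d1 d2 d3 d4 d5] := Dg x y h.
have [cy1 cy2 _ _ _] := Cf y y h.
have [dy1 dy2 _ _ _] := Dg y y h.
have [dh _ _ _ _] := Dg (x + h) y h.
have dl : `|g (x + h) - g x| <= D * `|h|.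
  by have [_ _ + _ _] := Dg (x + h) x h; rewrite addrAC subrr add0r.
have N1 := normr_ge0 h; have N2 := normr_ge0 (x - y).
have CD : 0 <= C * D by exact: mulr_ge0.
have M (a b c d : R) : `|a| <= c -> `|b| <= d -> `|a * b| <= c * d.
  by move=> *; rewrite normrM ler_pM.
split.
- apply: (le_trans (M _ _ _ _ c1 d1)); move: CD; clear; lra.
- apply: (le_trans (ler_normD _ _)).
  have := M _ _ _ _ c2 d1; have := M _ _ _ _ c1 d2.
  have : 0 <= C * D * `|h| by rewrite mulr_ge0.
  move: (`|h|) => p; clear; lra.
- have -> : f x * g x - f y * g y = (f x - f y) * g x + f y * (g x - g y) by ring.
  apply: (le_trans (ler_normD _ _)).
  have := M _ _ _ _ c3 d1; have := M _ _ _ _ cy1 d3.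
  have : 0 <= C * D * `|x - y| by rewrite mulr_ge0.
  move: (`|x - y|) => p; clear; lra.
- have -> : df x h * g x + f x * dg x h - (df y h * g y + f y * dg y h) =
     (df x h - df y h) * g x + df y h * (g x - g y) +
     ((f x - f y) * dg x h + f y * (dg x h - dg y h)) by ring.
  apply: (le_trans (ler_normD _ _)).
  have := ler_normD ((df x h - df y h) * g x) (df y h * (g x - g y)).
  have := ler_normD ((f x - f y) * dg x h) (f y * (dg x h - dg y h)).
  have := M _ _ _ _ c4 d1; have := M _ _ _ _ cy2 d3.
  have := M _ _ _ _ c3 d2; have := M _ _ _ _ cy1 d4.
  have : 0 <= C * D * `|x - y| * `|h| by rewrite !mulr_ge0.
  move: (`|x - y|) (`|h|) => p q.
  have -> : C * p * q * D = C * D * p * q by ring.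
  have -> : C * q * (D * p) = C * D * p * q by ring.
  have -> : C * p * (D * q) = C * D * p * q by ring.
  have -> : C * (D * p * q) = C * D * p * q by ring.
  have -> : 4 * C * D * p * q = 4 * (C * D * p * q) by ring.
  clear; lra.
- have -> : f (x + h) * g (x + h) - f x * g x - (df x h * g x + f x * dg x h) =
    (f (x + h) - f x - df x h) * g (x + h) + df x h * (g (x + h) - g x) +
    f x * (g (x + h) - g x - dg x h) by ring.
  apply: (le_trans (ler_normD _ _)).
  have := ler_normD ((f (x + h) - f x - df x h) * g (x + h)) (df x h * (g (x + h) - g x)).
  have := M _ _ _ _ c5 dh; have := M _ _ _ _ c2 dl; have := M _ _ _ _ c1 d5.
  have -> : 4 * C * D * `|h| ^+ 2 =
    C * `|h| ^+ 2 * D + C * `|h| * (D * `|h|) + C * (D * `|h| ^+ 2) +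
    C * D * `|h| ^+ 2 by ring.
  have : 0 <= C * D * `|h| ^+ 2 by rewrite mulr_ge0.
  clear; lra.
Qed.
End C11.

Section C11_consequences.
Context {R : realType}.

(** The quadratic remainder is little-o, and [df x] is a bounded linear map. *)
Lemma C11_is_diff (V : normedModType R) (f : V -> R) df x :
  C11 f df -> is_diff x (f : V -> R^o) (df x).
Proof.
move=> [lf [C C0 Cf]].
pose dfM := GRing.isLinear.Build _ _ _ _ _ (lf x).
pose dfL : {linear V -> R^o} := HB.pack (df x : V -> R^o) dfM.
have cdf : continuous dfL.
  move=> y; apply/cvgrPdist_le => e e0; near=> z.
  rewrite -linearB/=; have [_ c _ _ _] := Cf x x (y - z).
  apply: (le_trans c); rewrite (@le_trans _ _ ((C + 1) * `|y - z|))//.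
    by rewrite ler_wpM2r// lerDl.
  rewrite -ler_pdivlMl ?ltr_pwDr//; near: z.
  by apply: cvgr_dist_le; [exact: cvg_id|rewrite mulr_gt0// invr_gt0 ltr_pwDr].
have E : (f : V -> R^o) \o shift x = cst (f x) + dfL +o_ 0 id.
  apply/eqaddoP => e e0; near=> h => /=.
  have [_ _ _ _ c] := Cf x x h.
  have -> : (f \o shift x - (cst (f x) + dfL)) h = f (x + h) - f x - df x h.
    by rewrite !fctE /= opprD addrA (addrC h).
  apply: (le_trans c); rewrite expr2 mulrA ler_wpM2r//.
  rewrite (@le_trans _ _ ((C + 1) * `|h|))//; first by rewrite ler_wpM2r// lerDl.
  rewrite -ler_pdivlMl ?ltr_pwDr//; near: h.
  by apply: cvgr0_norm_le; [exact: cvg_id|rewrite mulr_gt0// invr_gt0 ltr_pwDr].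
have dE := diff_unique cdf E.
apply: DiffDef; last by rewrite dE.
by apply/diff_locallyP; rewrite dE.
Unshelve. all: by end_near. Qed.

Lemma C11_derive_continuous (V : normedModType R) (f : V -> R) df v :
  C11 f df -> continuous ((fun x => df x v) : V -> R^o).
Proof.
move=> [lf [C C0 Cf]] y; apply/cvgrPdist_le => e e0.
have K0 : 0 < (C * `|v| + 1) by rewrite ltr_pwDr// mulr_ge0.
near=> z; have [_ _ _ c _] := Cf y z v; apply: (le_trans c).
rewrite mulrAC (@le_trans _ _ ((C * `|v| + 1) * `|y - z|))//.
  by rewrite ler_wpM2r// lerDl.
rewrite -ler_pdivlMl//; near: z.
by apply: cvgr_dist_le; [exact: cvg_id|rewrite mulr_gt0// invr_gt0].
Unshelve. all: by end_near. Qed.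

Lemma C11_is_derive1 (f df : R -> R) (x : R) :
  C11 f (fun x h => df x * h) -> is_derive x 1 f (df x).
Proof.
move=> /(C11_is_diff x) H; have Df : differentiable f x by exact: ex_diff.
apply: DeriveDef; first exact/derivable1_diffP.
by rewrite deriveE// diff_val mulr1.
Qed.

Lemma C11_continuous (V : normedModType R) (f : V -> R) df : C11 f df -> continuous f.
Proof. by move=> /(C11_is_diff _) H x; apply: (@differentiable_continuous _ _ R^o). Qed.

(** gluing *)
(** Gluing at the ends of [[-1, 1]]: a segment that leaves the interval is cut
    at the endpoint [w] it crosses, where [f] and [df] vanish, so the estimates
    known inside the interval extend to the line with twice the constant. *)
Lemma C11_supported (f df : R -> R) (C : R) : 0 <= C ->
  (forall u, 1 <= `|u| -> f u = 0 /\ df u = 0) ->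
  (forall u v, `|u| <= 1 -> `|v| <= 1 ->
    [/\ `|f u| <= C, `|df u| <= C, `|f u - f v| <= C * `|u - v|,
        `|df u - df v| <= C * `|u - v|
      & `|f v - f u - df u * (v - u)| <= C * (v - u) ^+ 2]) ->
  C11 f (fun u h => df u * h).
Proof.
move=> C0 out inn; split.
  by move=> x a u v; rewrite mulrDr /GRing.scale/= mulrCA.
(* [w] is the endpoint of [-1, 1] on the side of [v]. *)
have cross u v : `|u| <= 1 -> 1 <= `|v| -> exists w : R,
   [/\ `|w| = 1, `|u - w| <= `|u - v|, `|v - w| <= `|u - v|, (u - w) ^+ 2 <= (u - v) ^+ 2
    & `|u - w| * `|v - w| <= (u - v) ^+ 2].
  rewrite ler_norml => /andP[u1 u2]; rewrite ler_normr => /orP[v1|v1].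
    exists 1; rewrite normr1.
    rewrite (@ler0_norm _ (u - 1)) ?(@ler0_norm _ (u - v)) ?(@ger0_norm _ (v - 1)); try lra.
    by rewrite !expr2; split; nra.
  exists (-1); rewrite normrN normr1 opprK.
  rewrite (@ger0_norm _ (u + 1)) ?(@ger0_norm _ (u - v)) ?(@ler0_norm _ (v + 1)); try lra.
  by rewrite !expr2; split; nra.
have lip (g : R -> R) : (forall u, 1 <= `|u| -> g u = 0) ->
    (forall u v, `|u| <= 1 -> `|v| <= 1 -> `|g u - g v| <= C * `|u - v|) ->
    forall u v, `|g u - g v| <= C * `|u - v|.
  move=> og ig.
  have half u v : `|u| <= 1 -> 1 <= `|v| -> `|g u - g v| <= C * `|u - v|.
    move=> u1 v1; have [w [w1 c1 _ _ _]] := cross _ _ u1 v1.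
    rewrite (og v v1) -(og w) ?w1//; apply: (le_trans (ig u w u1 _)); rewrite ?w1//.
    by rewrite ler_wpM2l.
  move=> u v; case: (leP `|u| 1) => [u1|/ltW u1].
    by case: (leP `|v| 1) => [v1|/ltW v1]; [exact: ig|exact: half].
  case: (leP `|v| 1) => [v1|/ltW v1]; first by rewrite distrC (distrC u v) half.
  by rewrite !og// subrr normr0 mulr_ge0.
exists (2 * C); first by rewrite mulr_ge0.
move=> u v h.
have bnd (g : R -> R) : (forall u, 1 <= `|u| -> g u = 0) ->
   (forall u, `|u| <= 1 -> `|g u| <= C) -> forall u, `|g u| <= 2 * C.
  move=> og ig t; case: (leP `|t| 1) => [/ig|/ltW/og ->]; last by rewrite normr0 mulr_ge0.
  by move: C0; lra.
have lipw (g : R -> R) : (forall u, 1 <= `|u| -> g u = 0) ->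
    (forall u v, `|u| <= 1 -> `|v| <= 1 -> `|g u - g v| <= C * `|u - v|) ->
    forall u v, `|g u - g v| <= 2 * C * `|u - v|.
  move=> og ig s t; apply: (le_trans (lip _ og ig s t)).
  by rewrite ler_wpM2r// ler_peMl// ler1n.
have o1 t : 1 <= `|t| -> f t = 0 by move=> /out[].
have o2 t : 1 <= `|t| -> df t = 0 by move=> /out[].
have i3 s t : `|s| <= 1 -> `|t| <= 1 -> `|f s - f t| <= C * `|s - t|.
  by move=> s1 t1; have [] := inn s t s1 t1.
have i4 s t : `|s| <= 1 -> `|t| <= 1 -> `|df s - df t| <= C * `|s - t|.
  by move=> s1 t1; have [] := inn s t s1 t1.
split.
- by apply: (bnd _ o1) => t t1; have [] := inn t t t1 t1.
- by rewrite normrM ler_wpM2r// (bnd _ o2)// => t t1; have [] := inn t t t1 t1.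
- exact: (lipw _ o1 i3).
- by rewrite -mulrBl normrM ler_wpM2r// (lipw _ o2 i4).
move: (u + h) (addrC u h) => s sE; have {sE}hE : h = s - u by rewrite sE addrK.
rewrite hE real_normK ?num_real//; have q0 : 0 <= (s - u) ^+ 2 by exact: sqr_ge0.
case: (leP `|u| 1) => [u1|/ltW u1]; case: (leP `|s| 1) => [s1|/ltW s1].
- have [_ _ _ _ c] := inn u s u1 s1; move: c (mulr_ge0 C0 q0); clear; lra.
- have [w [w1 c1 c2 c3 c4]] := cross u s u1 s1.
  rewrite (o1 s s1) -(o1 w) ?w1//.
  have -> : f w - f u - df u * (s - u) = (f w - f u - df u * (w - u)) + (df w - df u) * (s - w).
    by rewrite (o2 w) ?w1//; ring.
  apply: (le_trans (ler_normD _ _)).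
  have [_ _ _ _ c] := inn u w u1 ltac:(by rewrite w1).
  have := i4 w u ltac:(by rewrite w1) u1; rewrite normrM (distrC w) => c'.
  have h1 : `|df w - df u| * `|s - w| <= C * (`|u - w| * `|s - w|).
    by rewrite mulrA ler_wpM2r.
  have -> : (s - u) ^+ 2 = (u - s) ^+ 2 by ring.
  have E2 : (w - u) ^+ 2 = (u - w) ^+ 2 by ring.
  rewrite E2 in c.
  move: c h1 (ler_wpM2l C0 c3) (ler_wpM2l C0 c4); clear; lra.
- have [w [w1 c1 c2 c3 c4]] := cross s u s1 u1.
  rewrite (o1 u u1) (o2 u u1).
  have [_ _ _ _ c] := inn w s ltac:(by rewrite w1) s1.
  rewrite (o1 w) ?w1// (o2 w) ?w1// in c.
  apply: (@le_trans _ _ (C * (s - w) ^+ 2)); first by move: c; rewrite !mul0r.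
  move: (ler_wpM2l C0 c3) (mulr_ge0 C0 q0); clear; lra.
- by rewrite (o1 u u1) (o2 u u1) (o1 s s1) mul0r !subr0 normr0 mulr_ge0// mulr_ge0.
Qed.

End C11_consequences.

(** * The one-dimensional bump *)

Section kernel.
Context {R : realType}.
Implicit Types u v : R.

Definition hat u := Num.max 0 (1 - u ^+ 2).
(** The power 2 is the least integer for which the derivative is Lipschitz at
    the endpoints, and 15/16 makes the integral 1. *)
Definition bump u := 15 / 16 * hat u ^+ 2.
Definition dbump u := - (15 / 4) * u * hat u.
(** [xbump] and [dxbump] are the first-moment profile u |-> u k(u) and its
    derivative: the test field is a tensor product of one [xbump] and two
    [bump] factors. *)
Definition xbump u := u * bump u.
Definition dxbump u := bump u + u * dbump u.

Lemma hat_in u : `|u| <= 1 -> hat u = 1 - u ^+ 2.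
Proof.
by rewrite ler_norml => /andP[? ?]; rewrite /hat max_r// expr2; nra.
Qed.

Lemma hat_out u : 1 <= `|u| -> hat u = 0.
Proof.
by rewrite ler_normr => /orP[] ?; rewrite /hat max_l// expr2; nra.
Qed.

Lemma hat_ge0 u : 0 <= hat u.
Proof. by rewrite /hat le_max lexx. Qed.

Lemma hat_le1 u : hat u <= 1.
Proof. by rewrite /hat ge_max ler01/= gerBl sqr_ge0. Qed.

Lemma bump_ge0 u : 0 <= bump u.
Proof. by rewrite mulr_ge0// exprn_ge0// hat_ge0. Qed.

Lemma bump_le1 u : bump u <= 1.
Proof.
have := hat_ge0 u; have := hat_le1 u; rewrite /bump expr2; nra.
Qed.

Lemma bump_norm_le1 u : `|bump u| <= 1.
Proof. by rewrite ger0_norm ?bump_ge0// bump_le1. Qed.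

Lemma bump_out u : 1 <= `|u| -> bump u = 0.
Proof. by move=> /hat_out; rewrite /bump => ->; rewrite expr0n mulr0. Qed.

Lemma xbump_out u : 1 <= `|u| -> xbump u = 0.
Proof. by move=> /bump_out; rewrite /xbump => ->; rewrite mulr0. Qed.

Lemma xbump_norm_le1 u : `|xbump u| <= 1.
Proof.
case: (leP `|u| 1) => [u1|/ltW/xbump_out ->]; last by rewrite normr0.
by rewrite /xbump normrM -[leRHS]mulr1 ler_pM// bump_norm_le1.
Qed.

(** Inside the interval all increments factor through [u - v], respectively
    [(v - u) ^+ 2], with cofactors that are polynomials bounded on the square. *)
Lemma C11_bump : C11 bump (fun u h => dbump u * h).
Proof.
apply: (@C11_supported _ _ _ 12) => // [u /hat_out E|u v].
  by rewrite /bump /dbump E; split; ring.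
move=> u1 v1; rewrite /bump /dbump !hat_in//.
have /andP[{}u1 u2] : -1 <= u <= 1 by rewrite -ler_norml.
have /andP[{}v1 v2] : -1 <= v <= 1 by rewrite -ler_norml.
have U1 : 0 <= u ^+ 2 <= 1 by rewrite expr2; apply/andP; split; nra.
have V1 : 0 <= v ^+ 2 <= 1 by rewrite expr2; apply/andP; split; nra.
split.
- by rewrite ler_norml; apply/andP; split; move: U1 => /andP[]; nra.
- by rewrite ler_norml; apply/andP; split; move: U1 => /andP[]; nra.
- have -> : 15 / 16 * (1 - u ^+ 2) ^+ 2 - 15 / 16 * (1 - v ^+ 2) ^+ 2 =
     (- (15/16) * (u + v) * (1 - u ^+ 2 + (1 - v ^+ 2))) * (u - v) by field.
  rewrite normrM ler_wpM2r// ler_norml.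
  by apply/andP; split; move: U1 V1 => /andP[? ?] /andP[? ?]; nra.
- have -> : - (15 / 4) * u * (1 - u ^+ 2) - - (15 / 4) * v * (1 - v ^+ 2) =
     (- (15/4) * (1 - u ^+ 2 - v ^+ 2 - u * v)) * (u - v) by field.
  rewrite normrM ler_wpM2r// ler_norml.
  have := sqr_ge0 (u + v); have := sqr_ge0 (u - v); rewrite !expr2 => q1 q2.
  by apply/andP; split; move: U1 V1 => /andP[? ?] /andP[? ?]; nra.
- have -> : 15 / 16 * (1 - v ^+ 2) ^+ 2 - 15 / 16 * (1 - u ^+ 2) ^+ 2 -
     - (15 / 4) * u * (1 - u ^+ 2) * (v - u) =
     15 / 16 * ((u + v) ^+ 2 - 2 * (1 - u ^+ 2)) * (v - u) ^+ 2 by field.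
  rewrite normrM (@ger0_norm _ ((v - u) ^+ 2)) ?sqr_ge0// ler_wpM2r ?sqr_ge0//.
  have := sqr_ge0 (u + v); have := sqr_ge0 (u - v); rewrite ler_norml !expr2 => q1 q2.
  by apply/andP; split; move: U1 V1 => /andP[? ?] /andP[? ?]; nra.
Qed.

Lemma C11_xbump : C11 xbump (fun u h => dxbump u * h).
Proof.
apply: (@C11_supported _ _ _ 30) => // [u /hat_out E|u v].
  by rewrite /xbump /dxbump /bump /dbump E; split; ring.
move=> u1 v1; rewrite /xbump /dxbump /bump /dbump !hat_in//.
have /andP[{}u1 u2] : -1 <= u <= 1 by rewrite -ler_norml.
have /andP[{}v1 v2] : -1 <= v <= 1 by rewrite -ler_norml.
have U1 : 0 <= u ^+ 2 <= 1 by rewrite expr2; apply/andP; split; nra.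
have V1 : 0 <= v ^+ 2 <= 1 by rewrite expr2; apply/andP; split; nra.
have UV : -1 <= u * v <= 1 by apply/andP; split; nra.
have bnd (a b : R) (A B : R) : `|a| <= A -> `|b| <= B -> `|a * b| <= A * B.
  by move=> *; rewrite normrM ler_pM.
have bu : `|u| <= 1 by rewrite ler_norml u1.
have bv : `|v| <= 1 by rewrite ler_norml v1.
have bs : `|u + v| <= 2 by rewrite ler_norml; apply/andP; split; lra.
have bp : `|1 - u ^+ 2| <= 1 by rewrite ler_norml; move: U1 => /andP[? ?]; apply/andP; split; lra.
have bp2 : `|1 - u ^+ 2 + (1 - v ^+ 2)| <= 2.
  by rewrite ler_norml; move: U1 V1 => /andP[? ?] /andP[? ?]; apply/andP; split; lra.
split.
- have -> : u * (15 / 16 * (1 - u ^+ 2) ^+ 2) = 15 / 16 * (u * ((1 - u ^+ 2) * (1 - u ^+ 2))) by ring.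
  have := bnd _ _ _ _ bu (bnd _ _ _ _ bp bp).
  rewrite !ler_norml; clear; move=> /andP[? ?]; apply/andP; split; lra.
- have -> : 15 / 16 * (1 - u ^+ 2) ^+ 2 + u * (- (15 / 4) * u * (1 - u ^+ 2)) =
     15 / 16 * ((1 - u ^+ 2) * (1 - u ^+ 2)) - 15 / 4 * (u * (u * (1 - u ^+ 2))) by field.
  have := bnd _ _ _ _ bu (bnd _ _ _ _ bu bp); have := bnd _ _ _ _ bp bp.
  by rewrite !ler_norml; clear; move=> /andP[? ?] /andP[? ?]; apply/andP; split; lra.
- have -> : u * (15 / 16 * (1 - u ^+ 2) ^+ 2) - v * (15 / 16 * (1 - v ^+ 2) ^+ 2) =
     (15/16 * ((1 - u ^+ 2) * (1 - u ^+ 2)) -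
      15/16 * (v * ((u + v) * (1 - u ^+ 2 + (1 - v ^+ 2))))) * (u - v) by field.
  rewrite normrM ler_wpM2r//.
  have := bnd _ _ _ _ bv (bnd _ _ _ _ bs bp2); have := bnd _ _ _ _ bp bp.
  by rewrite !ler_norml; clear; move=> /andP[? ?] /andP[? ?]; apply/andP; split; lra.
- have -> : 15 / 16 * (1 - u ^+ 2) ^+ 2 + u * (- (15 / 4) * u * (1 - u ^+ 2)) -
      (15 / 16 * (1 - v ^+ 2) ^+ 2 + v * (- (15 / 4) * v * (1 - v ^+ 2))) =
     (15/16 * ((u + v) * (5 * (u ^+ 2 + v ^+ 2) - 6))) * (u - v) by field.
  rewrite normrM ler_wpM2r//.
  have b6 : `|5 * (u ^+ 2 + v ^+ 2) - 6| <= 6.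
    by rewrite ler_norml; move: U1 V1 => /andP[? ?] /andP[? ?]; apply/andP; split; lra.
  have := bnd _ _ _ _ bs b6.
  by rewrite !ler_norml; clear; move=> /andP[? ?]; apply/andP; split; lra.
- have -> : v * (15 / 16 * (1 - v ^+ 2) ^+ 2) - u * (15 / 16 * (1 - u ^+ 2) ^+ 2) -
      (15 / 16 * (1 - u ^+ 2) ^+ 2 + u * (- (15 / 4) * u * (1 - u ^+ 2))) * (v - u) =
     15 / 16 * (u * ((u + v) * (u + v) - 2 * (1 - u ^+ 2)) -
       (u + v) * (1 - u ^+ 2 + (1 - v ^+ 2))) * (v - u) ^+ 2 by field.
  rewrite normrM (@ger0_norm _ ((v - u) ^+ 2)) ?sqr_ge0// ler_wpM2r ?sqr_ge0//.
  have := bnd _ _ _ _ bu (bnd _ _ _ _ bs bs); have := bnd _ _ _ _ bs bp2.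
  have := bnd _ _ _ _ bu bp.
  by rewrite !ler_norml; clear; move=> /andP[? ?] /andP[? ?] /andP[? ?]; apply/andP; split; lra.
Qed.

Lemma dxbump_le u : `|dxbump u| <= 5.
Proof.
rewrite /dxbump /dbump /bump; case: (leP `|u| 1) => [u1|/ltW/hat_out ->]; last first.
  by rewrite expr0n !mulr0 addr0 normr0.
rewrite hat_in//; have /andP[{}u1 u2] : -1 <= u <= 1 by rewrite -ler_norml.
have /andP[U1 U2] : 0 <= u ^+ 2 <= 1 by rewrite expr2; apply/andP; split; nra.
by rewrite ler_norml; apply/andP; split; nra.
Qed.

End kernel.

(** * Moments of the bump and tensor products *)

Section moments.
Context {R : realType}.
Let leb := @lebesgue_measure R.

(** The fundamental theorem of calculus on the interval where
    [`|l * (x - y)| <= 1]; working directly with the reflected and dilated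
    argument replaces a change of variables. *)
Lemma integral_poly_supported (f : R -> R) (F : {poly R}) (l x : R) : 0 < l ->
  (forall u, `|u| <= 1 -> f u = F^`().[u]) -> (forall u, 1 <= `|u| -> f u = 0) ->
  leb.-integrable setT (EFin \o (fun y : R => f (l * (x - y)))) /\
  \int[leb]_y f (l * (x - y)) = (F.[1] - F.[-1]) / l.
Proof.
move=> l0 fin fout; have ln0 : l != 0 by rewrite gt_eqF.
pose a := x - l^-1; pose b := x + l^-1.
have ab : a < b by rewrite /a /b ltrD2l gtrN ?invr_gt0.
pose G (y : R) : R := - (F.[l * (x - y)] / l).
pose g (y : R) : R := F^`().[l * (x - y)].
have inn y : (y \in `[a, b]) = (`|l * (x - y)| <= 1).
  rewrite normrM (gtr0_norm l0) -ler_pdivlMl// mulr1 ler_distlC.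
  by rewrite in_itv/=.
have E : (fun y : R => f (l * (x - y))) = (g \_ `[a, b]).
  apply/funext => y; rewrite patchE; case: ifPn.
    by rewrite inE/= inn => /fin.
  by move/negP => h; apply: fout; apply/ltW; rewrite ltNge -inn; apply/negP; rewrite -[X in ~ X]inE.
have dlin y : is_derive (y : R) (1 : R) (fun y : R => l * (x - y)) (- l).
  have -> : (fun y : R => l * (x - y)) = horner ((l * x)%:P - l *: 'X).
    by apply/funext => z; rewrite !hornerE mulrBr.
  have := is_derive_poly ((l * x)%:P - l *: 'X) y.
  by rewrite !poly.derivE/= !hornerE.
have dG y : is_derive (y : R) (1 : R) G (g y).
  have := @is_derive1_comp R (horner F) _ y _ _ (is_derive_poly F _) (dlin y).
  move=> /(@is_deriveZ _ _ _ _ (- l^-1)) H.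
  have -> : G = - l^-1 *: (horner F \o (fun y : R => l * (x - y))).
    by apply/funext => z; rewrite /G /= mulrC -mulNr.
  apply: is_derive_eq H _; rewrite /g /GRing.scale/=; field; exact: ln0.
have cont (H : R -> R) (h : R -> R) : (forall y : R, is_derive y (1 : R) H (h y)) -> continuous H.
  move=> dH y; apply: (@differentiable_continuous _ _ R^o).
  by apply/derivable1_diffP; have [] := dH y.
have cG : continuous G by exact: cont dG.
have cg : continuous g.
  have dg z : is_derive (z : R) (1 : R) g (F^`()^`().[l * (x - z)] * - l).
    exact: (@is_derive1_comp R (horner F^`()) _ z _ _ (is_derive_poly _ _) (dlin z)).
  exact: cont dg.
have cgw : {within `[a, b], continuous g} by exact: continuous_subspaceT.
rewrite E; split.
  have -> : EFin \o (g \_ `[a, b]) = (EFin \o g) \_ `[a, b] by rewrite restrict_EFin.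
  have [H _] := @integrable_mkcond _ _ _ (@lebesgue_measure R) _ (EFin \o g) (measurable_itv `[a, b]).
  apply: H.
  apply: continuous_compact_integrable => //; exact: segment_compact.
rewrite -(Rintegral_mkcond leb `[a, b]) /Rintegral (@continuous_FTC2 _ g G)//.
- rewrite -EFinB/= /G /a /b.
  have -> : l * (x - (x + l^-1)) = -1 by field.
  have -> : l * (x - (x - l^-1)) = 1 by field.
  by field.
- split.
  + by move=> y _; have [] := dG y.
  + by apply: cvg_at_right_filter; exact: cG.
  + by apply: cvg_at_left_filter; exact: cG.
- by move=> y _; rewrite derive1E; have [_ ->] := dG y.
Qed.

Lemma integral_bump (l x : R) : 0 < l ->
  leb.-integrable setT (EFin \o (fun y : R => bump (l * (x - y)))) /\
  \int[leb]_y bump (l * (x - y)) = l^-1.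
Proof.
move=> l0.
have [|u /hat_out|i ->] := @integral_poly_supported bump
    ((15/16) *: ('X - (2/3) *: 'X^3 + (5^-1) *: 'X^5)) l x l0.
- by move=> u /hat_in E; rewrite /bump E !poly.derivE/= !hornerE/=; field.
- by rewrite /bump => ->; rewrite expr0n mulr0.
by split => //; rewrite !hornerE/=; field; rewrite gt_eqF.
Qed.

Lemma integral_xbump (l x : R) : 0 < l ->
  leb.-integrable setT (EFin \o (fun y : R => xbump (l * (x - y)))) /\
  \int[leb]_y xbump (l * (x - y)) = 0.
Proof.
move=> l0.
have [|u /hat_out|i ->] := @integral_poly_supported xbump
    ((15/16) *: (2^-1 *: 'X^2 - 2^-1 *: 'X^4 + (6^-1) *: 'X^6)) l x l0.
- by move=> u /hat_in E; rewrite /xbump /bump E !poly.derivE/= !hornerE/=; field.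
- by rewrite /xbump /bump => ->; rewrite expr0n !mulr0.
by split => //; rewrite !hornerE/=; field; rewrite gt_eqF.
Qed.

Lemma integral_sqr_bump (l x : R) : 0 < l ->
  leb.-integrable setT (EFin \o (fun y : R => (l * (x - y)) ^+ 2 * bump (l * (x - y)))) /\
  \int[leb]_y ((l * (x - y)) ^+ 2 * bump (l * (x - y))) = (7 * l)^-1.
Proof.
move=> l0.
have [|u /hat_out|i ->] := @integral_poly_supported (fun u => u ^+ 2 * bump u)
    ((15/16) *: (3^-1 *: 'X^3 - (2/5) *: 'X^5 + (7^-1) *: 'X^7)) l x l0.
- by move=> u /hat_in E; rewrite /bump E !poly.derivE/= !hornerE/=; field.
- by rewrite /bump => ->; rewrite expr0n !mulr0.
by split => //; rewrite !hornerE/=; field; rewrite gt_eqF.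
Qed.
End moments.

Section tensor.
Context {R : realType}.

Lemma integral_tensor d1 d2 (T1 : measurableType d1) (T2 : measurableType d2)
   (m1 : {sigma_finite_measure set T1 -> \bar R})
   (m2 : {sigma_finite_measure set T2 -> \bar R}) (f : T1 -> R) (g : T2 -> R) :
  m1.-integrable setT (EFin \o f) -> m2.-integrable setT (EFin \o g) ->
  (m1 \x m2)%E.-integrable setT (EFin \o (fun z => f z.1 * g z.2)) /\
  \int[(m1 \x m2)%E]_z (f z.1 * g z.2) = \int[m1]_x f x * \int[m2]_y g y.
Proof.
move=> intf intg.
have mf : measurable_fun setT f by move/integrableP : intf => [/measurable_EFinP].
have mg : measurable_fun setT g by move/integrableP : intg => [/measurable_EFinP].
have mfg : measurable_fun setT (EFin \o (fun z : T1 * T2 => f z.1 * g z.2)).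
  apply/measurable_EFinP/measurable_funM.
    exact: measurableT_comp mf measurable_fst.
  exact: measurableT_comp mg measurable_snd.
have I : (m1 \x m2)%E.-integrable setT (EFin \o (fun z : T1 * T2 => f z.1 * g z.2)).
  apply/(integrable12ltyP m1 m2 mfg).
  have E x : (\int[m2]_y `|(EFin \o (fun z : T1 * T2 => (f z.1 * g z.2)%R)) (x, y)| =
     `|f x|%:E * \int[m2]_y `|(EFin \o g) y|)%E.
    rewrite -ge0_integralZl//.
    - by apply: eq_integral => y _; rewrite /= normrM EFinM.
    - by apply/measurable_EFinP; exact: measurableT_comp.
  under eq_integral do rewrite E.
  have [_ fo] := integrableP _ _ _ intf; have [_ go] := integrableP _ _ _ intg.
  rewrite ge0_integralZr//; last 2 first.
  - by apply/measurable_EFinP; exact: measurableT_comp.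
  - by apply: integral_ge0 => y _; rewrite abse_ge0.
  rewrite lte_mul_pinfty//.
  - by apply: integral_ge0 => y _; rewrite lee_fin.
  - by rewrite ge0_fin_numE// integral_ge0// => y _; rewrite lee_fin.
split => //.
rewrite /Rintegral -(integral12_prod_meas1 I) /fubini_F/=.
under eq_integral.
  move=> x _; under eq_integral do rewrite EFinM.
  rewrite integralZl//. over.
have [gr gE] : exists r, (\int[m2]_x (g x)%:E)%E = r%:E.
  exists (fine (\int[m2]_x (g x)%:E)%E); rewrite fineK//.
  exact: (@integrable_fin_num _ _ _ _ _ measurableT _ intg).
rewrite gE; under eq_integral do rewrite muleC.
by rewrite integralZl// fineM//= 1?mulrC// (@integrable_fin_num _ _ _ _ _ measurableT _ intf).
Qed.

End tensor.

(** * Convolution *)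

Section real_integrable.
Context {R : realType} d (T : measurableType d) (mu : {measure set T -> \bar R}).
Implicit Types f g : T -> R.

(** Real-valued forms of the closure properties of extended-real
    integrability. *)
Lemma integrable_mulrl (c : R) f : mu.-integrable setT (EFin \o f) ->
  mu.-integrable setT (EFin \o (fun y => c * f y)).
Proof. exact: (@integrableZl _ _ _ mu _ measurableT c (EFin \o f)). Qed.

Lemma integrable_addr f g : mu.-integrable setT (EFin \o f) ->
  mu.-integrable setT (EFin \o g) ->
  mu.-integrable setT (EFin \o (fun y => f y + g y)).
Proof. exact: (@integrableD _ _ _ mu _ measurableT (EFin \o f) (EFin \o g)). Qed.

Lemma integrable_subr f g : mu.-integrable setT (EFin \o f) ->
  mu.-integrable setT (EFin \o g) ->
  mu.-integrable setT (EFin \o (fun y => f y - g y)).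
Proof. exact: (@integrableB _ _ _ mu _ measurableT (EFin \o f) (EFin \o g)). Qed.

Lemma integrable_normr f : mu.-integrable setT (EFin \o f) ->
  mu.-integrable setT (EFin \o (fun y => `|f y|)).
Proof. exact: (@integrable_norm _ _ _ mu). Qed.
End real_integrable.

Section bounded_multiplier.
Context {R : realType} d (T : measurableType d) (mu : {measure set T -> \bar R}).
Variable psi : T -> R.
Hypothesis ipsi : mu.-integrable setT (EFin \o psi).

Lemma integrable_mul_bounded (g : T -> R) (C : R) :
  measurable_fun setT g -> (forall y, `|g y| <= C) ->
  mu.-integrable setT (EFin \o (fun y => psi y * g y)).
Proof.
move=> mg gC.
have mpsi : measurable_fun setT psi by move/integrableP : ipsi => [/measurable_EFinP].
apply: (@le_integrable _ _ _ mu _ measurableT _ (fun y => C%:E * (EFin \o psi) y)%E).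
- by apply/measurable_EFinP; exact: measurable_funM.
- move=> y _ /=; rewrite lee_fin !normrM mulrC ler_wpM2r//.
  exact: le_trans (gC y) (ler_norm _).
- exact: integrableZl.
Qed.

Lemma le_norm_int_mul (g : T -> R) (C : R) :
  measurable_fun setT g -> (forall y, `|g y| <= C) ->
  `| \int[mu]_y (psi y * g y) | <= C * \int[mu]_y `|psi y|.
Proof.
move=> mg gC; have I := integrable_mul_bounded mg gC.
apply: (le_trans (le_normr_Rintegral measurableT I)).
have In : mu.-integrable setT (EFin \o (fun y => `|psi y|)) by exact: integrable_normr.
rewrite -RintegralZl//; apply: le_Rintegral => //.
- exact: integrable_normr.
- exact: integrable_mulrl.
- by move=> y _; rewrite normrM mulrC ler_wpM2r.
Qed.
End bounded_multiplier.

Section convol.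
Context {R : realType}.
Local Notation T3 := (R * R * R)%type.
Local Notation mu := (@lebesgue3 R).

Lemma measurable_x1 : measurable_fun setT (fun z : T3 => z.1.1).
Proof. exact: measurableT_comp measurable_fst measurable_fst. Qed.

Lemma measurable_x2 : measurable_fun setT (fun z : T3 => z.1.2).
Proof. exact: measurableT_comp measurable_snd measurable_fst. Qed.

Lemma measurable_x3 : measurable_fun setT (fun z : T3 => z.2).
Proof. exact: measurable_snd. Qed.

Lemma norm_x1 (z : T3) : `|z.1.1| <= `|z|.
Proof. by rewrite !prod_normE !le_max lexx. Qed.

Lemma norm_x2 (z : T3) : `|z.1.2| <= `|z|.
Proof. by rewrite !prod_normE !le_max lexx orbT. Qed.

Lemma norm_x3 (z : T3) : `|z.2| <= `|z|.
Proof. by rewrite !prod_normE !le_max lexx orbT. Qed.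

Definition convol (psi f : T3 -> R) (x : T3) : R := \int[mu]_y (psi y * f (x - y)).

Lemma measurable_reflect (x : T3) : measurable_fun setT (fun y : T3 => x - y).
Proof.
apply/measurable_fun_pairP; split; first (apply/measurable_fun_pairP; split).
- exact: (measurable_funB (measurable_cst x.1.1) measurable_x1).
- exact: (measurable_funB (measurable_cst x.1.2) measurable_x2).
- exact: (measurable_funB (measurable_cst x.2) measurable_x3).
Qed.

Lemma measurable_translate_reflect (f : T3 -> R) (x : T3) :
  measurable_fun setT f -> measurable_fun setT (fun y : T3 => f (x - y)).
Proof. by move=> mf; apply: measurableT_comp mf (measurable_reflect x). Qed.

(** Differentiation falls on the kernel: every clause of [C11] for the
    convolution is the integral of the same clause for [f (x - y)] against
    [psi]. *)
Lemma C11_convol (psi : T3 -> R) (f : T3 -> R) (df : T3 -> T3 -> R) :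
  mu.-integrable setT (EFin \o psi) ->
  C11 f df -> measurable_fun setT f -> (forall h, measurable_fun setT (df ^~ h)) ->
  C11 (convol psi f) (fun x h => convol psi (df ^~ h) x).
Proof.
move=> ipsi [lf [C C0 Cf]] mf mdf.
have mfx x := measurable_translate_reflect x mf.
have mdx h x := measurable_translate_reflect x (mdf h).
have If x : mu.-integrable setT (EFin \o (fun y => psi y * f (x - y))).
  by apply: (integrable_mul_bounded ipsi (C := C) (mfx x)) => y; have [] := Cf (x - y) 0 0.
have Id h x : mu.-integrable setT (EFin \o (fun y => psi y * df (x - y) h)).
  by apply: (integrable_mul_bounded ipsi (C := C * `|h|) (mdx h x)) => y; have [] := Cf (x - y) 0 h.
split.
  move=> x a u v; rewrite /convol /GRing.scale/= -RintegralZl// -RintegralD//.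
    by apply: eq_Rintegral => y _; rewrite lf /GRing.scale/=; ring.
  exact: integrable_mulrl.
have I0 : 0 <= \int[mu]_y `|psi y| by apply: Rintegral_ge0.
exists (C * \int[mu]_y `|psi y|) => [|x y h]; first exact: mulr_ge0.
split.
- by apply: (le_norm_int_mul ipsi (mfx x)) => z; have [] := Cf (x - z) 0 0.
- rewrite mulrAC; apply: (le_norm_int_mul ipsi (mdx h x)) => z.
  by have [] := Cf (x - z) 0 h.
- rewrite /convol -RintegralB//.
  under eq_Rintegral do rewrite -mulrBr.
  rewrite mulrAC; apply: (le_norm_int_mul ipsi) => [|z]; first exact: measurable_funB (mfx x) (mfx y).
  have [_ _ + _ _] := Cf (x - z) (y - z) h.
  by have -> : x - z - (y - z) = x - y by rewrite opprB addrA subrK.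
- rewrite /convol -RintegralB//.
  under eq_Rintegral do rewrite -mulrBr.
  have -> : C * \int[mu]_y `|psi y| * `|x - y| * `|h| =
    C * `|x - y| * `|h| * \int[mu]_y `|psi y| by ring.
  apply: (le_norm_int_mul ipsi) => [|z]; first exact: measurable_funB (mdx h x) (mdx h y).
  have [_ _ _ + _] := Cf (x - z) (y - z) h.
  by have -> : x - z - (y - z) = x - y by rewrite opprB addrA subrK.
- rewrite /convol -RintegralB// -RintegralB//; last exact: integrable_subr.
  under eq_Rintegral do rewrite -!mulrBr.
  rewrite mulrAC.
  apply: (le_norm_int_mul ipsi) => [|z].
    exact: measurable_funB (measurable_funB (mfx (x + h)) (mfx x)) (mdx h x).
  have [_ _ _ _] := Cf (x - z) (y - z) h.
  by have -> : x + h - z = x - z + h by rewrite addrAC.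
Qed.

Definition tens (a b c : R -> R) (z : T3) := a z.1.1 * b z.1.2 * c z.2.

Definition dtens (a b c a' b' c' : R -> R) (z h : T3) :=
  (a' z.1.1 * h.1.1 * b z.1.2 + a z.1.1 * (b' z.1.2 * h.1.2)) * c z.2 +
  a z.1.1 * b z.1.2 * (c' z.2 * h.2).

Lemma C11_tens (a b c a' b' c' : R -> R) :
  C11 a (fun u h => a' u * h) -> C11 b (fun u h => b' u * h) ->
  C11 c (fun u h => c' u * h) ->
  C11 (tens a b c) (dtens a b c a' b' c').
Proof.
move=> Ca Cb Cc.
apply: C11_mul; first apply: C11_mul.
- by apply: (@C11_comp _ _ _ (fun z : T3 => z.1.1) a _ 1) Ca => // z; rewrite mul1r norm_x1.
- by apply: (@C11_comp _ _ _ (fun z : T3 => z.1.2) b _ 1) Cb => // z; rewrite mul1r norm_x2.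
- by apply: (@C11_comp _ _ _ (fun z : T3 => z.2) c _ 1) Cc => // z; rewrite mul1r norm_x3.
Qed.

Lemma measurable_tens (a b c : R -> R) : measurable_fun setT a ->
  measurable_fun setT b -> measurable_fun setT c -> measurable_fun setT (tens a b c).
Proof.
move=> ma mb mc; apply: measurable_funM; first apply: measurable_funM.
- exact: measurableT_comp ma measurable_x1.
- exact: measurableT_comp mb measurable_x2.
- exact: measurableT_comp mc measurable_x3.
Qed.

Lemma measurable_dtens (a b c a' b' c' : R -> R) h : measurable_fun setT a ->
  measurable_fun setT b -> measurable_fun setT c ->
  measurable_fun setT a' ->
  measurable_fun setT b' -> measurable_fun setT c' ->
  measurable_fun setT (dtens a b c a' b' c' ^~ h).
Proof.
move=> ma mb mc ma' mb' mc'.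
have -> : dtens a b c a' b' c' ^~ h = (fun z => h.1.1 * tens a' b c z +
   h.1.2 * tens a b' c z + h.2 * tens a b c' z).
  by apply/funext => z; rewrite /dtens /tens; ring.
by apply: measurable_funD; first apply: measurable_funD;
  apply: measurable_funM => //; exact: measurable_tens.
Qed.

Lemma integral_tens (a b c : R -> R) :
  (@lebesgue_measure R).-integrable setT (EFin \o a) ->
  (@lebesgue_measure R).-integrable setT (EFin \o b) ->
  (@lebesgue_measure R).-integrable setT (EFin \o c) ->
  mu.-integrable setT (EFin \o tens a b c) /\
  \int[mu]_z tens a b c z = (\int[@lebesgue_measure R]_x a x) *
    (\int[@lebesgue_measure R]_x b x) * (\int[@lebesgue_measure R]_x c x).
Proof.
move=> ia ib ic.
have [iab eab] := integral_tensor ia ib.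
have [iabc eabc] := @integral_tensor R _ _ _ _ (@lebesgue2 R) (@lebesgue_measure R) _ _ iab ic.
by split => //; rewrite -eab -eabc.
Qed.
End convol.

(** * The test field *)

Lemma C11_scale (R : realType) (V : normedModType R) (f : V -> R) df c :
  C11 f df -> C11 (fun x => c * f x) (fun x h => c * df x h).
Proof.
move=> [lf [C C0 Cf]]; split.
  by move=> x a u v; rewrite lf /GRing.scale/=; ring.
exists (`|c| * C) => [|x y h]; first exact: mulr_ge0.
have [c1 c2 c3 c4 c5] := Cf x y h.
have M (a b : R) : `|a| <= b -> `|c * a| <= `|c| * b by rewrite normrM => /ler_wpM2l; exact.
rewrite -!mulrBr; split; first exact: M.
- by rewrite -mulrA M.
- by rewrite -mulrA M.
- by rewrite -(mulrA _ C) -mulrA M.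
- by rewrite -mulrA M.
Qed.

Section field.
Context {R : realType}.
Local Notation T3 := (R * R * R)%type.
Local Notation mu := (@lebesgue3 R).
Implicit Types (l : R) (psi : T3 -> R) (z x y : T3).

Definition bump3 : T3 -> R := tens bump bump bump.
(** The divergence of z |-> k(z) z, that is 3 k(z) + z . grad k(z). *)
Definition div_bump3 z :=
  tens dxbump bump bump z + tens bump dxbump bump z + tens bump bump dxbump z.

(** The convolution of [psi] with G_l(z) = l^2 k(l z) z.  One factor [l] is
    absorbed in the argument of [xbump], which leaves the factor [l] in front. *)
Definition field l psi x : T3 :=
  (convol psi (fun z => l * tens xbump bump bump (l *: z)) x,
   convol psi (fun z => l * tens bump xbump bump (l *: z)) x,
   convol psi (fun z => l * tens bump bump xbump (l *: z)) x).

Lemma measurable_C11 (f df : R -> R) : C11 f (fun u h => df u * h) ->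
  measurable_fun setT f /\ measurable_fun setT df.
Proof.
move=> Cf; split; apply: continuous_measurable_fun.
  exact: C11_continuous Cf.
move=> x; have := @C11_derive_continuous R R f _ 1 Cf.
  by move=> /(_ x); under eq_fun do rewrite mulr1.
Qed.

Lemma measurable_bump : measurable_fun setT (@bump R).
Proof. by have [] := measurable_C11 (@C11_bump R). Qed.
Lemma measurable_dbump : measurable_fun setT (@dbump R).
Proof. by have [] := measurable_C11 (@C11_bump R). Qed.
Lemma measurable_xbump : measurable_fun setT (@xbump R).
Proof. by have [] := measurable_C11 (@C11_xbump R). Qed.
Lemma measurable_dxbump : measurable_fun setT (@dxbump R).
Proof. by have [] := measurable_C11 (@C11_xbump R). Qed.

Lemma measurable_dilate l : measurable_fun setT (fun z => l *: z).
Proof.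
apply/measurable_fun_pairP; split; first (apply/measurable_fun_pairP; split).
- exact: (measurable_funM (measurable_cst l) measurable_x1).
- exact: (measurable_funM (measurable_cst l) measurable_x2).
- exact: (measurable_funM (measurable_cst l) measurable_x3).
Qed.

Lemma measurable_comp_dilate l (f : T3 -> R) : measurable_fun setT f ->
  measurable_fun setT (fun z => f (l *: z)).
Proof. by move=> mf; apply: measurableT_comp mf (measurable_dilate l). Qed.

Definition ddilate l (df : T3 -> T3 -> R) z (h : T3) := l * df (l *: z) (l *: h).

Lemma C11_dilate l (f : T3 -> R) df : 0 <= l -> C11 f df ->
  C11 (fun z => l * f (l *: z)) (ddilate l df).
Proof.
move=> l0 Cf; apply: C11_scale.
apply: (@C11_comp _ _ _ ( *:%R l : T3 -> T3) f df l) Cf.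
  by move=> a u v; rewrite scalerDr !scalerA mulrC.
by move=> z; rewrite normrZ ger0_norm.
Qed.

Section with_psi.
Variables (l : R) (psi : T3 -> R).
Hypothesis l0 : 0 <= l.
Hypothesis ipsi : mu.-integrable setT (EFin \o psi).

Lemma C11_convol_dilate (f : T3 -> R) df : C11 f df -> measurable_fun setT f ->
  (forall h, measurable_fun setT (df ^~ h)) ->
  C11 (convol psi (fun z => l * f (l *: z)))
      (fun x h => convol psi (ddilate l df ^~ h) x).
Proof.
move=> Cf mf mdf; apply: C11_convol => //.
- exact: C11_dilate.
- by apply: measurable_funM => //; exact: measurable_comp_dilate.
- move=> h; apply: measurable_funM => //.
  exact: (measurable_comp_dilate l (mdf (l *: h))).
Qed.

Let dg1 := dtens (@xbump R) bump bump dxbump dbump dbump.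
Let dg2 := dtens bump (@xbump R) bump dbump dxbump dbump.
Let dg3 := dtens bump bump (@xbump R) dbump dbump dxbump.

Let C1 := C11_tens (@C11_xbump R) (@C11_bump R) (@C11_bump R).
Let C2 := C11_tens (@C11_bump R) (@C11_xbump R) (@C11_bump R).
Let C3 := C11_tens (@C11_bump R) (@C11_bump R) (@C11_xbump R).

Let mk := measurable_bump. Let mdk := measurable_dbump.
Let mx := measurable_xbump. Let mdx := measurable_dxbump.

Let F1 := C11_convol_dilate C1 (measurable_tens mx mk mk)
  (fun h => measurable_dtens h mx mk mk mdx mdk mdk).
Let F2 := C11_convol_dilate C2 (measurable_tens mk mx mk)
  (fun h => measurable_dtens h mk mx mk mdk mdx mdk).
Let F3 := C11_convol_dilate C3 (measurable_tens mk mk mx)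
  (fun h => measurable_dtens h mk mk mx mdk mdk mdx).

Let dfield x (h : T3) : T3 :=
  (convol psi (ddilate l dg1 ^~ h) x,
   convol psi (ddilate l dg2 ^~ h) x, convol psi (ddilate l dg3 ^~ h) x).

Lemma is_diff_field x : is_diff x (field l psi) (dfield x).
Proof.
have D1 := C11_is_diff x F1; have D2 := C11_is_diff x F2.
have D3 := C11_is_diff x F3.
exact: (@is_diff_pair _ _ _ _ _ _ _ _ x (@is_diff_pair _ _ _ _ _ _ _ _ x D1 D2) D3).
Qed.

Lemma derive_field x v : 'D_v (field l psi) x = dfield x v.
Proof.
have D := is_diff_field x.
by rewrite deriveE ?diff_val//; exact: ex_diff.
Qed.

Lemma C1_field_field : C1_field (field l psi).
Proof.
split=> [x|v]; first by have D := is_diff_field x; exact: ex_diff.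
under eq_fun do rewrite derive_field.
move=> x.
exact: (cvg_pair (cvg_pair (@C11_derive_continuous _ _ _ _ v F1 x)
  (@C11_derive_continuous _ _ _ _ v F2 x)) (@C11_derive_continuous _ _ _ _ v F3 x)).
Qed.

Lemma convolDr_bounded (f g : T3 -> R) (C D : R) x :
  measurable_fun setT f -> measurable_fun setT g ->
  (forall z, `|f z| <= C) -> (forall z, `|g z| <= D) ->
  convol psi (fun z => f z + g z) x = convol psi f x + convol psi g x.
Proof.
move=> mf mg fC gD; rewrite /convol -RintegralD//.
- by apply: eq_Rintegral => y _; rewrite mulrDr.
- exact: (integrable_mul_bounded ipsi (C := C) (measurable_translate_reflect x mf)).
- exact: (integrable_mul_bounded ipsi (C := D) (measurable_translate_reflect x mg)).
Qed.

Lemma tens_le (a b c : R -> R) (A B C : R) z : (forall u, `|a u| <= A) ->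
  (forall u, `|b u| <= B) -> (forall u, `|c u| <= C) -> `|tens a b c z| <= A * B * C.
Proof.
by move=> aA bB cC; rewrite /tens !normrM; apply: ler_pM => //; apply: ler_pM.
Qed.

Let nk := @bump_norm_le1 R.

Lemma div_bump3_le z : `|div_bump3 z| <= 15.
Proof.
have := tens_le z (@dxbump_le R) nk nk; have := tens_le z nk (@dxbump_le R) nk.
have := tens_le z nk nk (@dxbump_le R); rewrite /div_bump3 => a b c.
apply: (le_trans (ler_normD _ _)); have := ler_normD (tens dxbump bump bump z) (tens bump dxbump bump z).
lra.
Qed.

(** The divergence of the field is the convolution of [psi] with
    d/dl (l^3 k(l z)), see [is_derive_moll]. *)
Lemma div3_field x :
  div3 (field l psi) x = convol psi (fun z => l ^+ 2 * div_bump3 (l *: z)) x.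
Proof.
rewrite /div3 !derive_field /dfield/=.
have E1 : (ddilate l dg1 ^~ (e1 R)) = (fun z => l ^+ 2 * tens dxbump bump bump (l *: z)).
  by apply/funext => z; rewrite /ddilate /dg1 /dtens /tens /e1 /= /GRing.scale/=; ring.
have E2 : (ddilate l dg2 ^~ (e2 R)) = (fun z => l ^+ 2 * tens bump dxbump bump (l *: z)).
  by apply/funext => z; rewrite /ddilate /dg2 /dtens /tens /e2 /= /GRing.scale/=; ring.
have E3 : (ddilate l dg3 ^~ (e3 R)) = (fun z => l ^+ 2 * tens bump bump dxbump (l *: z)).
  by apply/funext => z; rewrite /ddilate /dg3 /dtens /tens /e3 /= /GRing.scale/=; ring.
have M (a b c : R -> R) : measurable_fun setT a -> measurable_fun setT b ->
    measurable_fun setT c -> measurable_fun setT (fun z => l ^+ 2 * tens a b c (l *: z)).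
  move=> ma mb mc; apply: measurable_funM => //.
  exact: (measurable_comp_dilate l (measurable_tens ma mb mc)).
have B (f : T3 -> R) D : (forall z, `|f z| <= D) -> forall z, `|l ^+ 2 * f (l *: z)| <= l ^+ 2 * D.
  by move=> fD z; rewrite normrM ger0_norm ?sqr_ge0// ler_wpM2l// sqr_ge0.
have B1 := B _ _ (fun z => tens_le z (@dxbump_le R) nk nk).
have B2 := B _ _ (fun z => tens_le z nk (@dxbump_le R) nk).
have B3 := B _ _ (fun z => tens_le z nk nk (@dxbump_le R)).
rewrite E1 E2 E3 -(convolDr_bounded _ (M _ _ _ mdx mk mk) (M _ _ _ mk mdx mk) B1 B2).
have B12 z : `|l ^+ 2 * tens dxbump bump bump (l *: z) + l ^+ 2 * tens bump dxbump bump (l *: z)| <=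
    l ^+ 2 * (5 * 1 * 1) + l ^+ 2 * (1 * 5 * 1).
  by apply: (le_trans (ler_normD _ _)); apply: lerD.
rewrite -(convolDr_bounded _ (measurable_funD (M _ _ _ mdx mk mk) (M _ _ _ mk mdx mk))
  (M _ _ _ mk mk mdx) B12 B3).
by congr (convol psi _ x); apply/funext => z; rewrite /div_bump3 !mulrDr.
Qed.

End with_psi.

Lemma tens_out (a b c : R -> R) z : (forall u, 1 <= `|u| -> a u = 0) ->
  (forall u, 1 <= `|u| -> b u = 0) -> (forall u, 1 <= `|u| -> c u = 0) ->
  1 <= `|z| -> tens a b c z = 0.
Proof.
move=> a0 b0 c0; rewrite /tens prod_normE le_max => /orP[|/c0 ->]; last by rewrite mulr0.
rewrite prod_normE le_max => /orP[/a0 ->|/b0 ->]; first by rewrite !mul0r.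
by rewrite mulr0 mul0r.
Qed.

Lemma convol_supported l psi (f : T3 -> R) (L : R) x : 0 < l ->
  (forall z, 1 <= `|z| -> f z = 0) -> (forall y, L <= `|y| -> psi y = 0) ->
  L + l^-1 <= `|x| -> convol psi (fun z => l * f (l *: z)) x = 0.
Proof.
move=> l0 f0 psi0 Lx; rewrite /convol; under eq_Rintegral.
  move=> y _; have -> : psi y * (l * f (l *: (x - y))) = 0.
    case: (leP L `|y|) => [/psi0 ->|yL]; first by rewrite mul0r.
    rewrite f0 ?mulr0// normrZ gtr0_norm// -ler_pdivrMl// mulr1.
    have := ler_normB x (x - y); have -> : x - (x - y) = y by rewrite opprB addrC subrK.
    have := ler_normD (x - y) y; rewrite subrK; lra.
  over.
by rewrite /Rintegral integral0.
Qed.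

(** The support of the field lies within distance 1/l of that of [psi]. *)
Lemma compactly_supported_field l psi (L : R) : 0 < l ->
  (forall y, L <= `|y| -> psi y = 0) -> compactly_supported (field l psi).
Proof.
move=> l0 psi0; pose M := L + l^-1.
have cM : compact (`[- M, M] `*` `[- M, M] `*` `[- M, M] : set T3).
  by apply: compact_setX; [apply: compact_setX|]; exact: segment_compact.
apply: (subclosed_compact _ cM); first exact: closed_closure.
have clM : closed (`[- M, M] `*` `[- M, M] `*` `[- M, M] : set T3).
  by apply: compact_closed => //; exact: norm_hausdorff.
rewrite [X in _ `<=` X]((closure_id _).1 clM); apply: closureS => x /= /eqP xn0.
have : `|x| <= M.
  rewrite leNgt; apply/negP => /ltW Mx; apply: xn0; rewrite /field.
  rewrite !(convol_supported l0 _ psi0)//.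
  - by move=> z; apply: tens_out; [exact: bump_out|exact: bump_out|exact: xbump_out].
  - by move=> z; apply: tens_out; [exact: bump_out|exact: xbump_out|exact: bump_out].
  - by move=> z; apply: tens_out; [exact: xbump_out|exact: bump_out|exact: bump_out].
rewrite !prod_normE !ge_max => /andP[/andP[a b] c].
by rewrite !in_itv/= -!ler_norml.
Qed.

End field.

(** * The length of the test field *)

Section field_bound.
Context {R : realType}.
Local Notation T3 := (R * R * R)%type.
Local Notation mu := (@lebesgue3 R).
Local Notation leb := (@lebesgue_measure R).
Implicit Types (l : R) (psi : T3 -> R) (z x y : T3).

Lemma integral_tens_dilate (a b c : R -> R) (l A B C : R) x :
  (forall s : R, leb.-integrable setT (EFin \o (fun y : R => a (l * (s - y)))) /\
     \int[leb]_y a (l * (s - y)) = A) ->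
  (forall s : R, leb.-integrable setT (EFin \o (fun y : R => b (l * (s - y)))) /\
     \int[leb]_y b (l * (s - y)) = B) ->
  (forall s : R, leb.-integrable setT (EFin \o (fun y : R => c (l * (s - y)))) /\
     \int[leb]_y c (l * (s - y)) = C) ->
  mu.-integrable setT (EFin \o (fun y => tens a b c (l *: (x - y)))) /\
  \int[mu]_y tens a b c (l *: (x - y)) = A * B * C.
Proof.
move=> /(_ x.1.1)[ia ea] /(_ x.1.2)[ib eb] /(_ x.2)[ic ec].
by have [] := integral_tens ia ib ic; rewrite ea eb ec.
Qed.

Definition sq_bump (u : R) : R := u ^+ 2 * bump u.

Lemma integral_lincomb2 (f g : T3 -> R) (A B : R) :
  mu.-integrable setT (EFin \o f) /\ \int[mu]_y f y = A ->
  mu.-integrable setT (EFin \o g) /\ \int[mu]_y g y = B ->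
  forall a b : R,
  mu.-integrable setT (EFin \o (fun y => a * f y + b * g y)) /\
  \int[mu]_y (a * f y + b * g y) = a * A + b * B.
Proof.
move=> [jf ef] [jg eg] a b; split.
  by apply: integrable_addr; exact: integrable_mulrl.
rewrite RintegralD//; try exact: integrable_mulrl.
by rewrite !RintegralZl// ef eg.
Qed.

Lemma integral_dot_bump3 l x (v : T3) : 0 < l ->
  mu.-integrable setT (EFin \o (fun y => dot3 v (l *: (x - y)) * bump3 (l *: (x - y)))) /\
  \int[mu]_y (dot3 v (l *: (x - y)) * bump3 (l *: (x - y))) = 0.
Proof.
move=> l0; pose K (s : R) := integral_bump s l0; pose X (s : R) := integral_xbump s l0.
have H1 := integral_tens_dilate x X K K.
have H2 := integral_tens_dilate x K X K.
have H3 := integral_tens_dilate x K K X.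
have H12 := integral_lincomb2 H1 H2 v.1.1 v.1.2.
have := integral_lincomb2 H12 H3 1 v.2.
have -> : (fun y => dot3 v (l *: (x - y)) * bump3 (l *: (x - y))) = (fun y =>
  1 * (v.1.1 * tens xbump bump bump (l *: (x - y)) + v.1.2 * tens bump xbump bump (l *: (x - y))) +
   v.2 * tens bump bump xbump (l *: (x - y))).
  by apply/funext => y; rewrite /dot3 /bump3 /tens /xbump; ring.
by move=> [I ->]; split => //; ring.
Qed.

(** The mixed second moments vanish since the bump is even; the diagonal ones
    are 1/7, so that the second moment is isotropic although the bump is not
    radial. *)
Lemma integral_sqdot_bump3 l x (v : T3) : 0 < l ->
  mu.-integrable setT (EFin \o (fun y => dot3 v (l *: (x - y)) ^+ 2 * bump3 (l *: (x - y)))) /\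
  \int[mu]_y (dot3 v (l *: (x - y)) ^+ 2 * bump3 (l *: (x - y))) = dot3 v v / (7 * l ^+ 3).
Proof.
move=> l0; pose K (s : R) := integral_bump s l0; pose X (s : R) := integral_xbump s l0.
have S (s : R) : leb.-integrable setT (EFin \o (fun y : R => sq_bump (l * (s - y)))) /\
    \int[leb]_y sq_bump (l * (s - y)) = (7 * l)^-1 by exact: integral_sqr_bump.
have H1 := integral_tens_dilate x S K K.
have H2 := integral_tens_dilate x K S K.
have H3 := integral_tens_dilate x K K S.
have H4 := integral_tens_dilate x X X K.
have H5 := integral_tens_dilate x X K X.
have H6 := integral_tens_dilate x K X X.
have H12 := integral_lincomb2 H1 H2 (v.1.1 ^+ 2) (v.1.2 ^+ 2).
have H34 := integral_lincomb2 H3 H4 (v.2 ^+ 2) (2 * v.1.1 * v.1.2).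
have H56 := integral_lincomb2 H5 H6 (2 * v.1.1 * v.2) (2 * v.1.2 * v.2).
have := integral_lincomb2 (integral_lincomb2 H12 H34 1 1) H56 1 1.
set F := (F in mu.-integrable _ (EFin \o F)).
have -> : (fun y => dot3 v (l *: (x - y)) ^+ 2 * bump3 (l *: (x - y))) = F.
  by apply/funext => y; rewrite /F /dot3 /bump3 /tens /xbump /sq_bump /=; ring.
move=> [I ->]; split => //; rewrite /dot3; field; exact: lt0r_neq0.
Qed.

Lemma integral_bump3 l x : 0 < l ->
  mu.-integrable setT (EFin \o (fun y => bump3 (l *: (x - y)))) /\
  \int[mu]_y bump3 (l *: (x - y)) = (l ^+ 3)^-1.
Proof.
move=> l0; pose K (s : R) := integral_bump s l0.
have [I E] := integral_tens_dilate x K K K; split => //; rewrite E.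
by field; exact: lt0r_neq0.
Qed.

Lemma bump3_ge0 z : 0 <= bump3 z.
Proof. by apply: mulr_ge0; [apply: mulr_ge0|]; exact: bump_ge0. Qed.

Lemma measurable_bump3 : measurable_fun setT (@bump3 R).
Proof. exact: (measurable_tens measurable_bump measurable_bump measurable_bump). Qed.

Lemma dot3_field l psi x (v : T3) : 0 < l -> mu.-integrable setT (EFin \o psi) ->
  dot3 v (field l psi x) = \int[mu]_y (psi y * (l * (dot3 v (l *: (x - y)) * bump3 (l *: (x - y))))).
Proof.
move=> l0 ip.
have nk := @bump_norm_le1 R; have nx := @xbump_norm_le1 R.
have M (a b c : R -> R) : measurable_fun setT a -> measurable_fun setT b ->
    measurable_fun setT c -> measurable_fun setT (fun y => tens a b c (l *: (x - y))).
  move=> ma mb mc.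
  exact: (measurable_translate_reflect x (measurable_comp_dilate l (measurable_tens ma mb mc))).
have I1 := integrable_mul_bounded ip (M _ _ _ measurable_xbump measurable_bump measurable_bump)
   (fun y => tens_le _ nx nk nk).
have I2 := integrable_mul_bounded ip (M _ _ _ measurable_bump measurable_xbump measurable_bump)
   (fun y => tens_le _ nk nx nk).
have I3 := integrable_mul_bounded ip (M _ _ _ measurable_bump measurable_bump measurable_xbump)
   (fun y => tens_le _ nk nk nx).
have H12 := integral_lincomb2 (conj I1 erefl) (conj I2 erefl) (v.1.1 * l) (v.1.2 * l).
have := integral_lincomb2 H12 (conj I3 erefl) 1 (v.2 * l).
set F := (F in mu.-integrable _ (EFin \o F)).
have -> : (fun y => psi y * (l * (dot3 v (l *: (x - y)) * bump3 (l *: (x - y))))) = F.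
  by apply/funext => y; rewrite /F /dot3 /bump3 /tens /xbump /=; ring.
have Z (f : T3 -> R) : mu.-integrable setT (EFin \o (fun y => psi y * f (l *: (x - y)))) ->
   convol psi (fun z => l * f (l *: z)) x = l * \int[mu]_y (psi y * f (l *: (x - y))).
  move=> I; rewrite -RintegralZl// /convol; apply: eq_Rintegral => y _; ring.
by move=> [_ ->]; rewrite /dot3 /= !Z//; ring.
Qed.

Lemma dot3_ge0 (v : T3) : 0 <= dot3 v v.
Proof. by rewrite /dot3 -!expr2 !addr_ge0// sqr_ge0. Qed.

(** Young's inequality; the weight 8/3 approximates the reciprocal of the
    standard deviation 1/sqrt 7 of the bump, for which the final bound is best
    possible. *)
Lemma young_norm (n w : R) :
  `|n * w| <= 2^-1 * (8/3 * w ^+ 2 + 3/8 * n ^+ 2).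
Proof.
have s1 := sqr_ge0 (8/3 * w - n); have s2 := sqr_ge0 (8/3 * w + n).
have e1 : (8/3 * w - n) ^+ 2 = 8/3 * (8/3 * w ^+ 2 + 3/8 * n ^+ 2 - 2 * (n * w)) by field.
have e2 : (8/3 * w + n) ^+ 2 = 8/3 * (8/3 * w ^+ 2 + 3/8 * n ^+ 2 + 2 * (n * w)) by field.
by rewrite ler_norml; apply/andP; split; lra.
Qed.

Lemma dist_half (p : R) : 0 <= p <= 1 -> `|p - 2^-1| <= 2^-1.
Proof. by move=> /andP[p0 p1]; rewrite ler_norml; apply/andP; split; lra. Qed.

(** For v the value of the field at x, |v|^2 is the integral of
    psi(y) v . G_l(x - y).  The kernel is odd, so 1/2 can be subtracted from
    [psi], which halves the bound coming from 0 <= psi <= 1; Young's inequality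
    and the moments of the bump then give |v| <= (127/672) / l^2. *)
Lemma enorm3_field l psi x : 0 < l -> mu.-integrable setT (EFin \o psi) ->
  (forall y, 0 <= psi y <= 1) -> enorm3 (field l psi x) <= 19 / 100 / l ^+ 2.
Proof.
move=> l0 ip psi01; set v := field l psi x.
pose g y := dot3 v (l *: (x - y)) * bump3 (l *: (x - y)).
have [ig eg] : mu.-integrable setT (EFin \o g) /\ \int[mu]_y g y = 0 by exact: integral_dot_bump3.
have [isq esq] := integral_sqdot_bump3 x v l0.
have [ik ek] := integral_bump3 x l0.
pose n := enorm3 v.
have n0 : 0 <= n by exact: sqrtr_ge0.
have n2 : n ^+ 2 = dot3 v v by rewrite sqr_sqrtr// dot3_ge0.
rewrite -/n; have [->|nn0] := eqVneq n 0; first by rewrite divr_ge0 ?exprn_ge0 ?ltW.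
have mpsi : measurable_fun setT psi by move/integrableP : ip => [/measurable_EFinP].
have ipg : mu.-integrable setT (EFin \o (fun y => psi y * g y)).
  have [] := integral_lincomb2 (conj (integrable_mul_bounded ig (C := 1) mpsi _) erefl) (conj ig erefl) 1 0.
    by move=> y; have /andP[? ?] := psi01 y; rewrite ger0_norm.
  by under eq_fun do rewrite mul1r mul0r addr0 mulrC.
have E : dot3 v v = l * \int[mu]_y (psi y * g y - 2^-1 * g y).
  rewrite RintegralB//; last exact: integrable_mulrl.
  rewrite (RintegralZl _ _ ig)// eg mulr0 subr0 -RintegralZl// {2}/v dot3_field//.
  by apply: eq_Rintegral => y _; rewrite /g; ring.
pose F y := 2^-1 * (2^-1 * (8/3)) * (dot3 v (l *: (x - y)) ^+ 2 * bump3 (l *: (x - y))) +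
   2^-1 * (2^-1 * (3/8) * n ^+ 2) * bump3 (l *: (x - y)).
have [iF eF] : mu.-integrable setT (EFin \o F) /\ \int[mu]_y F y = 127 / 672 * n ^+ 2 / l ^+ 3.
  have [IF ->] := integral_lincomb2 (conj isq esq) (conj ik ek)
    (2^-1 * (2^-1 * (8/3))) (2^-1 * (2^-1 * (3/8) * n ^+ 2)).
  by split => //; rewrite -n2; field; exact: lt0r_neq0.
have key : n * dot3 v v <= l * (127 / 672 * n ^+ 2 / l ^+ 3).
  rewrite E mulrCA ler_pM2l// -eF -RintegralZl//; last first.
    by apply: integrable_subr => //; exact: integrable_mulrl.
  apply: le_Rintegral => //.
    by apply/integrable_mulrl/integrable_subr => //; exact: integrable_mulrl.
  move=> y _; rewrite /F /g; set w := dot3 v _; set k := bump3 _.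
  have k0 : 0 <= k by exact: bump3_ge0.
  have -> : n * (psi y * (w * k) - 2^-1 * (w * k)) = ((psi y - 2^-1) * (n * w)) * k by ring.
  have -> : 2^-1 * (2^-1 * (8 / 3)) * (w ^+ 2 * k) + 2^-1 * (2^-1 * (3 / 8) * n ^+ 2) * k
    = (2^-1 * (2^-1 * (8/3 * w ^+ 2 + 3/8 * n ^+ 2))) * k by ring.
  rewrite ler_wpM2r//.
  apply: le_trans (ler_norm _) _; rewrite normrM; apply: ler_pM => //.
    exact: dist_half.
  exact: young_norm.
have np : 0 < n by rewrite lt_neqAle eq_sym nn0.
have l2 : 0 < l ^+ 2 by exact: exprn_gt0.
rewrite ler_pdivlMr//.
have : n ^+ 2 * (n * l ^+ 2) <= n ^+ 2 * (127/672).
  move: key; rewrite -n2.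
  have -> : l * (127 / 672 * n ^+ 2 / l ^+ 3) = (n ^+ 2 * (127 / 672)) / l ^+ 2.
    by field; exact: lt0r_neq0.
  by rewrite ler_pdivlMr//; apply: le_trans; rewrite le_eqVlt; apply/orP; left; apply/eqP; ring.
rewrite ler_pM2l ?exprn_gt0// => h; apply: (le_trans h); clear; lra.
Qed.
End field_bound.

(** * Overlap at varying scale *)

Section flow.
Context {R : realType}.
Local Notation T3 := (R * R * R)%type.
Local Notation mu := (@lebesgue3 R).
Implicit Types (l : R) (psi chi : T3 -> R) (z x y : T3).

(** The bump rescaled to length 1/l and to mass 1. *)
Definition moll l z : R := l ^+ 3 * bump3 (l *: z).

(** The identity behind the flow: the scale derivative of the mollifier is a
    divergence. *)
Lemma is_derive_moll l z :
  is_derive (l : R) (1 : R) (fun l => moll l z) (l ^+ 2 * div_bump3 (l *: z)).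
Proof.
have lin (u : R) : is_derive (l : R) (1 : R) (fun l : R => l * u) u.
  have -> : (fun l : R => l * u) = u *: id by apply/funext => t; rewrite mulrC.
  by apply: is_derive_eq; rewrite /GRing.scale/= mulr1.
have dk (u : R) : is_derive (l : R) (1 : R) (fun l : R => bump (l * u)) (dbump (l * u) * u).
  exact: (@is_derive1_comp R bump (fun l => l * u) l _ _ (C11_is_derive1 _ (@C11_bump R)) (lin u)).
have d3 : is_derive (l : R) (1 : R) (fun l : R => l ^+ 3) (3 * l ^+ 2).
  have -> : (fun l : R => l ^+ 3) = (id : R -> R) ^+ 3 by apply/funext.
  by apply: is_derive_eq; rewrite /GRing.scale/= mulr1.
have H := is_deriveM d3 (is_deriveM (is_deriveM (dk z.1.1) (dk z.1.2)) (dk z.2)).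
apply: (is_derive_eq H).
have -> : div_bump3 (l *: z) = dxbump (l * z.1.1) * bump (l * z.1.2) * bump (l * z.2) +
  bump (l * z.1.1) * dxbump (l * z.1.2) * bump (l * z.2) +
  bump (l * z.1.1) * bump (l * z.1.2) * dxbump (l * z.2) by [].
rewrite /dxbump !fctE /GRing.scale/=; ring.
Qed.

Section measurability.
Variable psi : T3 -> R.
Hypothesis psi0 : forall y, 0 <= psi y.
Hypothesis ipsi : mu.-integrable setT (EFin \o psi).

Let mpsi : measurable_fun setT psi.
Proof. by move/integrableP : ipsi => [/measurable_EFinP]. Qed.

Lemma measurable_sub3 : measurable_fun setT (fun p : T3 * T3 => p.1 - p.2).
Proof.
have m1 : measurable_fun setT (fst : T3 * T3 -> T3) by exact: measurable_fst.
have m2 : measurable_fun setT (snd : T3 * T3 -> T3) by exact: measurable_snd.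
apply/measurable_fun_pairP; split; first (apply/measurable_fun_pairP; split).
- exact: (measurable_funB (measurableT_comp (@measurable_x1 R) m1)
    (measurableT_comp (@measurable_x1 R) m2)).
- exact: (measurable_funB (measurableT_comp (@measurable_x2 R) m1)
    (measurableT_comp (@measurable_x2 R) m2)).
- exact: (measurable_funB (measurableT_comp (@measurable_x3 R) m1)
    (measurableT_comp (@measurable_x3 R) m2)).
Qed.

(** Adding the constant [C] to the kernel makes the integrand nonnegative, so
    that the measurability half of Tonelli's theorem applies. *)
Lemma measurable_convol (g : T3 -> R) (C : R) : measurable_fun setT g ->
  (forall z, `|g z| <= C) -> measurable_fun setT (convol psi g).
Proof.
move=> mg gC.
pose h (p : T3 * T3) : \bar R := (psi p.2 * (g (p.1 - p.2) + C))%:E.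
have mh : measurable_fun setT h.
  apply/measurable_EFinP; apply: measurable_funM.
    exact: measurableT_comp mpsi measurable_snd.
  exact: measurable_funD (measurableT_comp mg measurable_sub3) (measurable_cst C).
have h0 p : (0 <= h p)%E.
  by rewrite lee_fin mulr_ge0// -lerBlDr sub0r; have := gC (p.1 - p.2); rewrite ler_norml => /andP[].
have := @measurable_fun_fubini_tonelli_F _ _ _ _ R (@lebesgue3 R) h mh h0.
move=> mF.
have -> : convol psi g = (fun x => fine (fubini_F (@lebesgue3 R) h x) - C * \int[mu]_y psi y).
  apply/funext => x; rewrite /fubini_F /h /=.
  transitivity (\int[mu]_y (psi y * (g (x - y) + C)) - C * \int[mu]_y psi y); last by [].
  have ig := integrable_mul_bounded ipsi (C := C) (measurable_translate_reflect x mg) (fun y => gC _).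
  under eq_Rintegral do rewrite mulrDr.
  rewrite RintegralD//; last first.
    by under eq_fun do rewrite mulrC; exact: integrable_mulrl.
  by under [X in _ + X - _]eq_Rintegral do rewrite mulrC; rewrite RintegralZl// addrK.
apply: measurable_funB; last exact: measurable_cst.
exact: measurableT_comp mF.
Qed.
End measurability.

Lemma measurable_div_bump3 l : measurable_fun setT (fun z => l ^+ 2 * div_bump3 (l *: z)).
Proof.
apply: measurable_funM => //; apply: (measurable_comp_dilate l (f := @div_bump3 R)).
have mk := @measurable_bump R; have mx := @measurable_dxbump R.
by apply: measurable_funD; first apply: measurable_funD; exact: measurable_tens.
Qed.

Lemma measurable_moll l : measurable_fun setT (moll l).
Proof.
apply: measurable_funM => //; exact: (measurable_comp_dilate l (@measurable_bump3 R)).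
Qed.

Lemma bump3_le1 z : bump3 z <= 1.
Proof.
have nk := @bump_norm_le1 R.
by have := tens_le z nk nk nk; rewrite !mulr1; apply: le_trans; exact: ler_norm.
Qed.

Lemma moll_ge0 l z : 0 <= l -> 0 <= moll l z.
Proof. by move=> l0; apply: mulr_ge0; [exact: exprn_ge0|exact: bump3_ge0]. Qed.

Lemma moll_le l z : 0 <= l -> `|moll l z| <= l ^+ 3.
Proof.
move=> l0; rewrite ger0_norm ?moll_ge0// /moll ler_piMr ?exprn_ge0//; exact: bump3_le1.
Qed.

Lemma div_bump3_dilate_le l z : `|l ^+ 2 * div_bump3 (l *: z)| <= l ^+ 2 * 15.
Proof. by rewrite normrM ger0_norm ?sqr_ge0// ler_wpM2l ?sqr_ge0// div_bump3_le. Qed.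

(** Differentiation under the integral sign for a positive parameter, with a
    dominating function that is valid on ]0, 2a[. *)
Lemma is_derive_Rintegral d (T : measurableType d) (m : {measure set T -> \bar R})
    (f df : R -> T -> R) (G : T -> R) (a : R) : 0 < a ->
  (forall l, 0 < l -> m.-integrable setT (EFin \o f l)) ->
  (forall l (y : T), 0 < l -> is_derive (l : R) (1 : R) (f ^~ y) (df l y)) ->
  (forall y : T, 0 <= G y) -> m.-integrable setT (EFin \o G) ->
  (forall l (y : T), 0 < l -> l < 2 * a -> `|df l y| <= G y) ->
  is_derive (a : R) (1 : R) (fun l => \int[m]_y f l y) (\int[m]_y df a y).
Proof.
move=> a0 intf derf G0 iG Gub.
have Ia : `]0, (2 * a)[%classic a by rewrite /= in_itv/= a0/=; lra.
have I1 (l : R) : `]0, (2 * a)[%classic l -> 0 < l by rewrite /= in_itv/= => /andP[].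
have I2 (l : R) : `]0, (2 * a)[%classic l -> l < 2 * a by rewrite /= in_itv/= => /andP[].
have p1 l (y : T) : 0 < l -> partial1of2 f l y = df l y.
  by move=> l0; rewrite partial1of2E; have [_ ->] := derf l y l0.
have H1 l : `]0, (2 * a)[%classic l -> m.-integrable setT (EFin \o f l) by move=> /I1/intf.
have H2 l (y : T) : `]0, (2 * a)[%classic l -> [set: T] y -> derivable (f ^~ y) l 1.
  by move=> /I1 l0 _; have [] := derf l y l0.
have H3 l (y : T) : `]0, (2 * a)[%classic l -> [set: T] y -> `|partial1of2 f l y| <= G y.
  by move=> /[dup] /I1 l0 /I2 l2 _; rewrite p1// Gub.
apply: DeriveDef.
  exact: (derivable_under_integral measurableT Ia H1 H2 G0 iG H3).
rewrite -derive1E (differentiation_under_integral measurableT Ia H1 H2 G0 iG H3).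
by apply: eq_Rintegral => y _; rewrite p1.
Qed.

(** The test field built from psi = 0 is the zero field. *)
Lemma total_variation3_ge0 chi : (0 <= total_variation3 chi)%E.
Proof.
have i0 : mu.-integrable setT (EFin \o (fun _ : T3 => 0 : R)) by exact: integrable0.
have l0 : 0 < 1 :> R by [].
apply: ereal_sup_ubound; exists (field 1 (fun=> 0)).
  split.
  - exact: C1_field_field.
  - exact: (@compactly_supported_field _ _ _ 0 l0).
  - move=> x; apply: (le_trans (enorm3_field x l0 i0 _)) => [y|]; first by rewrite lexx ler01.
    by rewrite expr1n divr1; lra.
apply: integral0_eq => x _; rewrite div3_field// /convol.
under eq_Rintegral do rewrite mul0r.
by rewrite /Rintegral integral0 mulr0.
Qed.

Section flow.
Variables (psi chi : T3 -> R) (L P : R).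
Hypothesis psi01 : forall y, 0 <= psi y <= 1.
Hypothesis ipsi : mu.-integrable setT (EFin \o psi).
Hypothesis psiL : forall y, L <= `|y| -> psi y = 0.
Hypothesis ichi : mu.-integrable setT (EFin \o chi).
Hypothesis tvchi : (total_variation3 chi <= P%:E)%E.

Let psi0 y : 0 <= psi y. Proof. by have /andP[] := psi01 y. Qed.

Let ipsiM (g : T3 -> R) (C : R) x : measurable_fun setT g -> (forall z, `|g z| <= C) ->
   mu.-integrable setT (EFin \o (fun y => psi y * g (x - y))).
Proof. by move=> mg gC; exact: (integrable_mul_bounded ipsi (C := C) (measurable_translate_reflect x mg)). Qed.

Let sq_mono (l a c : R) : 0 < l -> l < 2 * a -> 0 <= c -> l ^+ 2 * c <= (2 * a) ^+ 2 * c.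
Proof.
by move=> l0 la c0; rewrite ler_wpM2r// ler_sqr ?nnegrE ?ltW// (lt_trans l0).
Qed.

Lemma is_derive_convol_moll l x : 0 < l ->
  is_derive (l : R) (1 : R) (fun l => convol psi (moll l) x) (div3 (field l psi) x).
Proof.
move=> l0; rewrite (div3_field (ltW l0))//.
have H := @is_derive_Rintegral _ _ mu (fun l y => psi y * moll l (x - y))
  (fun l y => psi y * (l ^+ 2 * div_bump3 (l *: (x - y))))
  (fun y => (2 * l) ^+ 2 * 15 * psi y) l l0.
rewrite /convol; apply: H.
- by move=> t t0; exact: (ipsiM x (measurable_moll t) (fun z => moll_le z (ltW t0))).
- by move=> t y t0; have H := is_derive_moll t (x - y); exact: (is_deriveZ (psi y) H).
- by move=> y; rewrite mulr_ge0// mulr_ge0// sqr_ge0.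
- exact: integrable_mulrl.
- move=> t y t0 tl; rewrite normrM ger0_norm// mulrC ler_wpM2r//.
  by apply: le_trans (div_bump3_dilate_le _ _) _; exact: sq_mono.
Qed.

Lemma div3_field_le l x : 0 < l -> `|div3 (field l psi) x| <= l ^+ 2 * 15 * \int[mu]_y psi y.
Proof.
move=> l0; rewrite (div3_field (ltW l0))//.
have := le_norm_int_mul ipsi (measurable_translate_reflect x (measurable_div_bump3 l))
  (fun y => div_bump3_dilate_le l (x - y)).
have -> : \int[mu]_y `|psi y| = \int[mu]_y psi y.
  by apply: eq_Rintegral => y _; rewrite ger0_norm.
exact.
Qed.

Lemma measurable_div3_field l : 0 < l -> measurable_fun setT (div3 (field l psi)).
Proof.
move=> l0; have -> : div3 (field l psi) = convol psi (fun z => l ^+ 2 * div_bump3 (l *: z)).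
  by apply/funext => x; rewrite (div3_field (ltW l0)).
exact: (measurable_convol psi0 ipsi (measurable_div_bump3 l) (div_bump3_dilate_le l)).
Qed.

Definition overlap l := \int[mu]_x (chi x * convol psi (moll l) x).

Lemma integrable_overlap l : 0 < l ->
  mu.-integrable setT (EFin \o (fun x => chi x * convol psi (moll l) x)).
Proof.
move=> l0.
apply: (integrable_mul_bounded ichi (C := l ^+ 3 * \int[mu]_y `|psi y|)).
  exact: (measurable_convol psi0 ipsi (measurable_moll l) (fun z => moll_le z (ltW l0))).
move=> x; exact: (le_norm_int_mul ipsi (measurable_translate_reflect x (measurable_moll l))
   (fun y => moll_le _ (ltW l0))).
Qed.

(** Two differentiations under the integral sign: in [is_derive_convol_moll]
    under the inner integral, here under the outer one. *)
Lemma is_derive_overlap l : 0 < l ->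
  is_derive (l : R) (1 : R) overlap (\int[mu]_x (chi x * div3 (field l psi) x)).
Proof.
move=> l0; have I0 : 0 <= \int[mu]_y psi y by exact: Rintegral_ge0.
apply: (@is_derive_Rintegral _ _ mu (fun l x => chi x * convol psi (moll l) x)
  (fun l x => chi x * div3 (field l psi) x)
  (fun x => (2 * l) ^+ 2 * (15 * \int[mu]_y psi y) * `|chi x|)) => //.
- exact: integrable_overlap.
- by move=> t y t0; have H := is_derive_convol_moll y t0; exact: (is_deriveZ (chi y) H).
- by move=> y; rewrite mulr_ge0// mulr_ge0 ?sqr_ge0// mulr_ge0.
- exact/integrable_mulrl/integrable_normr.
- move=> t y t0 tl; rewrite normrM mulrC ler_wpM2r//.
  apply: le_trans (div3_field_le _ t0) _; rewrite -mulrA; apply: sq_mono => //.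
  exact: mulr_ge0.
Qed.

(** The field divided by its maximal length is admissible in the supremum that
    defines the total variation. *)
Lemma overlap_derive_le l : 0 < l ->
  \int[mu]_x (chi x * div3 (field l psi) x) <= P * (19 / 100 / l ^+ 2).
Proof.
move=> l0; pose c := (19 / 100 / l ^+ 2)^-1.
have l2 : 0 < l ^+ 2 by exact: exprn_gt0.
have c0 : 0 < c by rewrite invr_gt0 divr_gt0.
pose phi := field l (fun y => c * psi y).
have ic : mu.-integrable setT (EFin \o (fun y => c * psi y)) by exact: integrable_mulrl.
have convZ (g : T3 -> R) C x : measurable_fun setT g -> (forall z, `|g z| <= C) ->
    convol (fun y => c * psi y) g x = c * convol psi g x.
  move=> mg gC; rewrite /convol -RintegralZl//; last exact: ipsiM mg gC.
  by apply: eq_Rintegral => y _; rewrite mulrA.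
have nk := @bump_norm_le1 R; have nx := @xbump_norm_le1 R.
have mk := @measurable_bump R; have mx := @measurable_xbump R.
have tb (a b d : R -> R) z : (forall u, `|a u| <= 1) -> (forall u, `|b u| <= 1) ->
    (forall u, `|d u| <= 1) -> `|l * tens a b d (l *: z)| <= l.
  move=> a1 b1 d1; rewrite normrM gtr0_norm// -[leRHS]mulr1 ler_pM2l//.
  by have := tens_le (l *: z) a1 b1 d1; rewrite !mulr1.
have mt (a b d : R -> R) : measurable_fun setT a -> measurable_fun setT b ->
    measurable_fun setT d -> measurable_fun setT (fun z => l * tens a b d (l *: z)).
  move=> ma mb md; apply: measurable_funM => //.
  exact: (measurable_comp_dilate l (measurable_tens ma mb md)).
have phiE x : phi x = c *: field l psi x.
  rewrite /phi /field (convZ _ _ _ (mt _ _ _ mx mk mk) (fun z => tb _ _ _ z nx nk nk)).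
  rewrite (convZ _ _ _ (mt _ _ _ mk mx mk) (fun z => tb _ _ _ z nk nx nk)).
  by rewrite (convZ _ _ _ (mt _ _ _ mk mk mx) (fun z => tb _ _ _ z nk nk nx)).
have divE x : div3 phi x = c * div3 (field l psi) x.
  rewrite /phi !(div3_field (ltW l0))//.
  exact: (convZ _ _ _ (measurable_div_bump3 l) (div_bump3_dilate_le l)).
have idiv : mu.-integrable setT (EFin \o (fun x => chi x * div3 (field l psi) x)).
  apply: (integrable_mul_bounded ichi (measurable_div3_field l0)) => x.
  exact: div3_field_le.
have : ((\int[mu]_x (chi x * div3 phi x)%:E) <= P%:E)%E.
  apply: le_trans tvchi; apply: ereal_sup_ubound; exists phi => //; split.
  - by apply: C1_field_field => //; exact: ltW.
  - by apply: (@compactly_supported_field _ _ _ L l0) => y /psiL ->; rewrite mulr0.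
  - move=> x; rewrite phiE.
    have -> : enorm3 (c *: field l psi x) = c * enorm3 (field l psi x).
      rewrite /enorm3; have -> : dot3 (c *: field l psi x) (c *: field l psi x) =
         c ^+ 2 * dot3 (field l psi x) (field l psi x).
        by rewrite /dot3 /= /GRing.scale/=; ring.
      by rewrite sqrtrM ?sqr_ge0// sqrtr_sqr gtr0_norm.
    by rewrite -ler_pdivlMl// mulr1 /c invrK enorm3_field.
under eq_integral do rewrite divE mulrCA EFinM.
rewrite integralZl// -(fineK (integrable_fin_num measurableT idiv)) -EFinM lee_fin.
by rewrite -ler_pdivlMl// /c invrK mulrC.
Qed.

(** The function l |-> overlap l + (19/100) P / l is nonincreasing. *)
Lemma overlap_le a b : 0 < a -> a <= b ->
  overlap b <= overlap a + P * (19 / 100) / a.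
Proof.
move=> a0 ab; pose g (l : R) := overlap l + P * (19 / 100) / l.
have dg l : 0 < l -> is_derive (l : R) (1 : R) g
    (\int[mu]_x (chi x * div3 (field l psi) x) - P * (19 / 100 / l ^+ 2)).
  move=> l0; have l0' : id l != 0 :> R by rewrite gt_eqF.
  have H1 := is_derive_overlap l0.
  have H2 := @is_deriveV R id l 1 1 l0' (is_derive_id _ _).
  have H := is_deriveD H1 (is_deriveZ (P * (19/100)) H2).
  apply: (is_derive_eq H); rewrite /GRing.scale/= mulr1; field; exact: lt0r_neq0.
have P0 : 0 <= P by rewrite -lee_fin (le_trans (total_variation3_ge0 chi)).
have : g b <= g a.
  apply: (@ler0_derive1_nincr _ g a b) => //.
  - by move=> l; rewrite in_itv/= => /andP[al _]; have [] := dg l (lt_trans a0 al).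
  - move=> l; rewrite in_itv/= => /andP[al _].
    have [_] := dg l (lt_trans a0 al); rewrite derive1E => ->.
    by rewrite subr_le0 overlap_derive_le// (lt_trans a0).
  - apply: derivable_within_continuous => l; rewrite in_itv/= => /andP[al _].
    by have [] := dg l (lt_le_trans a0 al).
rewrite /g; have : 0 <= P * (19 / 100) / b.
  by rewrite divr_ge0 ?mulr_ge0// (le_trans (ltW a0)).
move: (overlap a) (overlap b) (P * (19 / 100) / a) (P * (19 / 100) / b) => u v s t *; lra.
Qed.
End flow.
End flow.

(** * Lipschitz functions are dense *)

Section unit_interval.
Context {R : realType}.
Implicit Types a b s t : R.

Lemma dist01_le1 a b : 0 <= a <= 1 -> 0 <= b <= 1 -> `|a - b| <= 1.
Proof.
by move=> /andP[? ?] /andP[? ?]; rewrite ler_norml; apply/andP; split; lra.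
Qed.

Lemma onem01_le1 a : 0 <= a <= 1 -> `|1 - a| <= 1.
Proof. by move=> a01; apply: dist01_le1 => //; rewrite ler01 lexx. Qed.

Lemma or01 a b : 0 <= a <= 1 -> 0 <= b <= 1 -> 0 <= 1 - (1 - a) * (1 - b) <= 1.
Proof. by move=> /andP[? ?] /andP[? ?]; apply/andP; split; nra. Qed.

Lemma or01_lipschitz a b a' b' : 0 <= a' <= 1 -> 0 <= b <= 1 ->
  `|1 - (1 - a) * (1 - b) - (1 - (1 - a') * (1 - b'))| <= `|a - a'| + `|b - b'|.
Proof.
move=> a01 b01.
have -> : 1 - (1 - a) * (1 - b) - (1 - (1 - a') * (1 - b')) =
  (a - a') * (1 - b) + (1 - a') * (b - b') by ring.
apply: le_trans (ler_normD _ _) _; rewrite !normrM; apply: lerD.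
  by rewrite ler_piMr// onem01_le1.
by rewrite ler_piMl// onem01_le1.
Qed.

Lemma clamp_dist s t :
  `|Num.min 1 (Num.max 0 s) - Num.min 1 (Num.max 0 t)| <= `|s - t|.
Proof.
have max_dist a b : `|Num.max 0 a - Num.max 0 b| <= `|a - b|.
  rewrite !maxr_absE !sub0r !normrN.
  have -> : (0 + a + `|a|) / 2 - (0 + b + `|b|) / 2 =
    2^-1 * ((a - b) + (`|a| - `|b|)) by field.
  rewrite normrM ger0_norm//.
  by have := ler_normD (a - b) (`|a| - `|b|); have := ler_dist_dist a b; clear; lra.
apply: le_trans (max_dist s t); move: (Num.max 0 s) (Num.max 0 t) => a b.
rewrite !minr_absE.
have -> : (1 + a - `|1 - a|) / 2 - (1 + b - `|1 - b|) / 2 =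
  2^-1 * ((a - b) - (`|1 - a| - `|1 - b|)) by field.
rewrite normrM ger0_norm//.
have := ler_normB (a - b) (`|1 - a| - `|1 - b|); have := ler_dist_dist (1 - a) (1 - b).
have -> : 1 - a - (1 - b) = - (a - b) by ring.
by rewrite normrN; clear; lra.
Qed.
End unit_interval.

Section small.
Context {R : realType} d (T : measurableType d) (mu : {measure set T -> \bar R}).

Lemma dominated_integral_small (w : T -> R) (h_ : nat -> T -> R) :
  mu.-integrable setT (EFin \o w) -> (forall y, 0 <= w y) ->
  (forall n, measurable_fun setT (h_ n)) -> (forall n y, `|h_ n y| <= 1) ->
  (forall y, h_ ^~ y @ \oo --> 0) ->
  forall e : R, 0 < e -> exists n, \int[mu]_y (w y * `|h_ n y|) <= e.
Proof.
move=> iw w0 mh h1 hcvg e e0.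
have mw : measurable_fun setT w by move/integrableP : iw => [/measurable_EFinP].
pose f_ n y := (w y * `|h_ n y|)%:E.
have mf n : measurable_fun setT (f_ n).
  by apply/measurable_EFinP/measurable_funM => //; exact: measurableT_comp.
have cf : {ae mu, forall x, [set: T] x -> f_ ^~ x @ \oo --> (cst 0%E x : \bar R)}.
  apply/aeW => y _; apply: cvg_EFin; first exact: nearW.
  rewrite /f_ /comp /= -[X in _ --> X](mulr0 (w y)).
  by apply: cvgMr; rewrite -(@normr0 _ R); exact: cvg_norm (hcvg y).
have bf : {ae mu, forall x n, [set: T] x -> (`|f_ n x| <= (EFin \o w) x)%E}.
  by apply/aeW => y n _; rewrite /f_ lee_fin normrM normr_id ger0_norm// ler_piMr.
have [_ _] := dominated_convergence measurableT mf (measurable_cst _) cf iw bf.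
rewrite /= integral0 => /fine_cvg /cvgrPdist_le /(_ e e0) [n _ /(_ n (leqnn n))].
rewrite /= sub0r normrN => H; exists n; apply: le_trans H; rewrite ler_norm//.
Qed.
End small.

Section density.
Context {R : realType}.
Local Notation T3 := (R * R * R)%type.
Local Notation mu := (@lebesgue3 R).
Implicit Types (l : R) (psi chi w f : T3 -> R) (x y z : T3).

Definition lipschitz3 f := exists K : R, forall x y, `|f x - f y| <= K * `|x - y|.

(** Sets whose indicator is a limit of Lipschitz functions with values in
    [0, 1] in the L^1 norm weighted by [w].  They form a sigma-algebra: finite
    unions are approximated directly, and countable ones by finite ones since
    the weight is integrable.  Hence it suffices to approximate generators. *)
Definition lip_approximable w : set (set T3) := [set A | measurable A /\
  forall e : R, 0 < e -> exists f, [/\ measurable_fun setT f, forall y, 0 <= f y <= 1,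
    lipschitz3 f & \int[mu]_y (w y * `|\1_A y - f y|) <= e]].

Section approximable.
Variable w : T3 -> R.
Hypothesis iw : mu.-integrable setT (EFin \o w).
Hypothesis w0 : forall y, 0 <= w y.

Lemma ind01 (A : set T3) y : 0 <= (\1_A y : R) <= 1.
Proof. by rewrite indicE; case: (_ \in _); rewrite /= lexx ler01. Qed.

Let iwM (g : T3 -> R) : measurable_fun setT g -> (forall y, `|g y| <= 1) ->
  mu.-integrable setT (EFin \o (fun y => w y * `|g y|)).
Proof.
move=> mg g1; apply: (integrable_mul_bounded iw (C := 1)).
  exact: measurableT_comp.
by move=> y; rewrite normr_id.
Qed.

Let i1 (A : set T3) (f : T3 -> R) : measurable A -> measurable_fun setT f ->
  (forall y, 0 <= f y <= 1) ->
  mu.-integrable setT (EFin \o (fun y => w y * `|\1_A y - f y|)).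
Proof.
move=> mA mf f01; apply: iwM; first by apply: measurable_funB => //; exact: measurable_indic.
by move=> y; apply: dist01_le1 => //; exact: ind01.
Qed.

Lemma approx_setC A : lip_approximable w A -> lip_approximable w (~` A).
Proof.
move=> [mA appA]; split; first exact: measurableC.
move=> e /appA[f [mf f01 [K lf] ef]]; exists (fun y => 1 - f y); split.
- exact: measurable_funB.
- by move=> y; have /andP[a b] := f01 y; apply/andP; split; lra.
- exists K => x y; have -> : 1 - f x - (1 - f y) = - (f x - f y) by ring.
  by rewrite normrN.
- apply: le_trans ef; rewrite le_eqVlt; apply/orP; left; apply/eqP.
  apply: eq_Rintegral => y _; congr (w y * _); rewrite -normrN; congr `|_|.
  by rewrite !indicE in_setC; case: (y \in A) => /=; ring.
Qed.

(** The function 1 - (1 - f)(1 - g) approximates the union. *)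
Lemma approx_setU A B : lip_approximable w A -> lip_approximable w B ->
  lip_approximable w (A `|` B).
Proof.
move=> [mA appA] [mB appB]; split; first exact: measurableU.
move=> e e0; have e2 : 0 < e / 2 by rewrite divr_gt0.
have [f [mf f01 [K lf] ef]] := appA _ e2; have [g [mg g01 [H lg] eg]] := appB _ e2.
exists (fun y => 1 - (1 - f y) * (1 - g y)); split.
- by apply: measurable_funB => //; apply: measurable_funM; apply: measurable_funB.
- by move=> y; exact: or01.
- exists (K + H) => x y.
  apply: le_trans (or01_lipschitz _ _ (f01 y) (g01 x)) _.
  by rewrite mulrDl; exact: lerD.
- have iA := i1 mA mf f01; have iB := i1 mB mg g01.
  apply: (@le_trans _ _ (\int[mu]_y (w y * `|\1_A y - f y| + w y * `|\1_B y - g y|))).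
    apply: le_Rintegral => //.
    + apply: i1 => //; first exact: measurableU.
        by apply: measurable_funB => //; apply: measurable_funM; apply: measurable_funB.
      by move=> y; exact: or01.
    + exact: integrable_addr.
    + move=> y _; rewrite -mulrDr ler_wpM2l//.
      have -> : \1_(A `|` B) y = 1 - (1 - \1_A y) * (1 - \1_B y) :> R.
        by rewrite !indicE in_setU; case: (y \in A); case: (y \in B) => /=; ring.
      exact: (or01_lipschitz _ _ (f01 y) (ind01 B y)).
  by rewrite RintegralD//; move: ef eg; clear; lra.
Qed.

Lemma approx_set0 : lip_approximable w set0.
Proof.
split=> // e e0; exists (fun=> 0); split => //.
- by move=> y; rewrite lexx ler01.
- by exists 0 => x y; rewrite subrr normr0 mul0r.
- under eq_Rintegral do rewrite indic0 subrr normr0 mulr0.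
  by rewrite /Rintegral integral0 ltW.
Qed.

Lemma approx_bigcup (F : nat -> set T3) : (forall n, lip_approximable w (F n)) ->
  lip_approximable w (\bigcup_n F n).
Proof.
move=> aF; have mF n : measurable (F n) by have [] := aF n.
have mU : measurable (\bigcup_n F n) by exact: bigcup_measurable.
have aG n : lip_approximable w (\big[setU/set0]_(i < n) F i).
  elim: n => [|n IH]; first by rewrite big_ord0; exact: approx_set0.
  by rewrite big_ord_recr/=; exact: approx_setU.
split=> // e e0; have e2 : 0 < e / 2 by rewrite divr_gt0.
pose h_ n y := \1_(\bigcup_n F n) y - \1_(\big[setU/set0]_(i < n) F i) y : R.
have mh n : measurable_fun setT (h_ n).
  by apply: measurable_funB; apply: measurable_indic => //; have [] := aG n.
have h1 n y : `|h_ n y| <= 1.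
  by apply: dist01_le1; exact: ind01.
have hc y : h_ ^~ y @ \oo --> 0.
  have [[k _ Fky]|nF] := pselect ((\bigcup_n F n) y).
    apply: cvg_near_cst; exists k.+1 => // n /= kn.
    have yG : (\big[setU/set0]_(i < n) F i) y by rewrite -bigcup_mkord; exists k.
    have yU : (\bigcup_n F n) y by exists k.
    by rewrite /h_ !indicE (mem_set yG) (mem_set yU) subrr.
  apply: cvg_near_cst; apply: nearW => n.
  have nG : ~ (\big[setU/set0]_(i < n) F i) y.
    by move=> Gy; apply: nF; move: Gy; rewrite -bigcup_mkord => -[k _ Fky]; exists k.
  by rewrite /h_ !indicE (memNset nF) (memNset nG) subrr.
have [n hn] := dominated_integral_small iw w0 mh h1 hc e2.
have [mG /(_ _ e2)[f [mf f01 lf ef]]] := aG n.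
exists f; split => //.
have iG := i1 mG mf f01; have ih := iwM (mh n) (h1 n).
apply: (@le_trans _ _ (\int[mu]_y (w y * `|h_ n y| +
    w y * `|\1_(\big[setU/set0]_(i < n) F i) y - f y|))).
  apply: le_Rintegral => //; first exact: i1.
    exact: integrable_addr.
  move=> y _; rewrite -mulrDr ler_wpM2l//.
  apply: le_trans (ler_normD _ _); rewrite /h_ addrA subrK//.
by rewrite RintegralD//; move: hn ef; clear; lra.
Qed.

Lemma approx_sigma_algebra : sigma_algebra setT (lip_approximable w).
Proof.
split; [exact: approx_set0| |exact: approx_bigcup].
by move=> A aA; rewrite setTD; exact: approx_setC.
Qed.

(** The clamped affine functions min(1, max(0, n (p - a))) increase to the
    indicator of [p > a]. *)
Lemma approx_ray (p : T3 -> R) (a : R) : measurable_fun setT p ->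
  (forall x y, `|p x - p y| <= `|x - y|) ->
  lip_approximable w (p @^-1` `]a, +oo[).
Proof.
move=> mp lp; have mA : measurable (p @^-1` `]a, +oo[%classic).
  by rewrite -[X in measurable X]setTI; exact: mp.
split=> // e e0.
pose f_ (n : nat) y : R := Num.min 1 (Num.max 0 (n%:R * (p y - a))).
have f01 n y : 0 <= f_ n y <= 1.
  by rewrite /f_ le_min ler01 le_max lexx ge_min lexx.
have mf n : measurable_fun setT (f_ n).
  by apply: measurable_minr => //; apply: measurable_maxr => //; apply: measurable_funM => //;
    apply: measurable_funB.
pose h_ n y := \1_(p @^-1` `]a, +oo[) y - f_ n y : R.
have mh n : measurable_fun setT (h_ n).
  by apply: measurable_funB => //; exact: measurable_indic.
have h1 n y : `|h_ n y| <= 1.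
  by apply: dist01_le1 => //; exact: ind01.
have hc y : h_ ^~ y @ \oo --> 0.
  have [pa|pa] := ltP a (p y).
    apply: cvg_near_cst; near=> n.
    rewrite /h_ indicE mem_set/=; last by rewrite in_itv/= pa.
    rewrite /f_ (@max_r _ _ 0); last by rewrite mulr_ge0// subr_ge0 ltW.
    rewrite min_l ?subrr// -ler_pdivrMr ?subr_gt0// div1r.
    near: n; exact: nbhs_infty_ger.
  apply: cvg_near_cst; apply: nearW => n.
  rewrite /h_ indicE memNset/=; last by rewrite in_itv/= andbT ltNge pa.
  by rewrite /f_ max_l ?min_r ?subrr// mulr_ge0_le0// subr_le0.
have [n hn] := dominated_integral_small iw w0 mh h1 hc e0.
exists (f_ n); split => //; exists n%:R => x y.
apply: le_trans (clamp_dist _ _) _.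
have -> : n%:R * (p x - a) - n%:R * (p y - a) = n%:R * (p x - p y) by ring.
by rewrite normrM ger0_norm// ler_wpM2l.
Unshelve. all: by end_near. Qed.

Lemma sigma_algebra_preimage (T1 T2 : Type) (p : T1 -> T2) (D : set (set T1)) :
  sigma_algebra setT D -> sigma_algebra setT [set C | D (p @^-1` C)].
Proof.
move=> [D0 DC DU]; split => /=.
- by rewrite preimage_set0.
- by move=> A /DC; rewrite !setTD preimage_setC.
- by move=> A DA; rewrite preimage_bigcup; exact: DU.
Qed.

Lemma approx_coordinate (p : T3 -> R) : measurable_fun setT p ->
  (forall x y, `|p x - p y| <= `|x - y|) ->
  forall B : set R, measurable B -> lip_approximable w (p @^-1` B).
Proof.
move=> mp lp B; rewrite [X in X -> _](_ : _ = (@RGenOInfty.G R).-sigma.-measurable B); last first.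
  by rewrite -RGenOInfty.measurableE.
move: B; apply: smallest_sub; first exact: (sigma_algebra_preimage p approx_sigma_algebra).
by move=> _ [a ->]; exact: approx_ray.
Qed.

(** The product sigma-algebra is generated by the coordinate preimages of
    Borel sets, and the Borel sets by rays. *)
Lemma lip_approximable_measurable (A : set T3) : measurable A -> lip_approximable w A.
Proof.
move: A; apply: smallest_sub; first exact: approx_sigma_algebra.
move=> A [[B mB <-]|[B mB <-]]; rewrite setTI; last first.
  exact: (approx_coordinate (@measurable_x3 R) (fun x y => norm_x3 (x - y)) mB).
move: B mB; apply: smallest_sub.
  exact: (sigma_algebra_preimage fst approx_sigma_algebra).
move=> B [[C mC <-]|[C mC <-]]; rewrite setTI /=.
  exact: (approx_coordinate (@measurable_x1 R) (fun x y => norm_x1 (x - y)) mC).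
exact: (approx_coordinate (@measurable_x2 R) (fun x y => norm_x2 (x - y)) mC).
Qed.

End approximable.
End density.

(** * Perimeter controls the mass lost by mollification *)

Section mass_bound.
Context {R : realType}.
Local Notation T3 := (R * R * R)%type.
Local Notation mu := (@lebesgue3 R).
Implicit Types (l : R) (psi chi w f : T3 -> R) (x y z : T3).

Lemma bump_le (u : R) : bump u <= 15 / 16.
Proof.
have := hat_ge0 u; have := hat_le1 u; rewrite /bump expr2; move: (hat u) => h *; nra.
Qed.

(** A dilated bump normalised to the value 1 at the origin: a Lipschitz,
    integrable and compactly supported weight that tends to 1. *)
Definition cutoff (n : nat) y : R := (16 / 15) ^+ 3 * bump3 (n.+1%:R^-1 *: (0 - y)).

Lemma cutoff01 n y : 0 <= cutoff n y <= 1.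
Proof.
rewrite /cutoff mulr_ge0 ?bump3_ge0//=.
have nk (u : R) : `|bump u| <= 15/16 by rewrite ger0_norm ?bump_ge0// bump_le.
have := tens_le (n.+1%:R^-1 *: (0 - y)) nk nk nk.
rewrite ger0_norm ?bump3_ge0//; rewrite -/bump3; move: (bump3 _) => k kle.
by move: kle; rewrite !exprS expr0; lra.
Qed.

Lemma measurable_cutoff n : measurable_fun setT (cutoff n).
Proof.
apply: measurable_funM => //; apply: (measurable_translate_reflect (f := fun z => bump3 (_ *: z))).
exact: (measurable_comp_dilate _ (@measurable_bump3 R)).
Qed.

Lemma integrable_cutoff n : mu.-integrable setT (EFin \o cutoff n).
Proof. by apply: integrable_mulrl; have [] := @integral_bump3 R n.+1%:R^-1 0. Qed.

Lemma bump3_lipschitz : exists2 K : R, 0 <= K & forall x y, `|bump3 x - bump3 y| <= K * `|x - y|.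
Proof.
have [_ [K K0 H]] := C11_tens (@C11_bump R) (@C11_bump R) (@C11_bump R).
by exists K => // x y; have [] := H x y 0.
Qed.

Lemma cutoff_lipschitz n : lipschitz3 (cutoff n).
Proof.
have [K K0 H] := bump3_lipschitz.
exists ((16/15) ^+ 3 * (K * n.+1%:R^-1)) => x y.
rewrite /cutoff -mulrBr normrM ger0_norm// -[leRHS]mulrA ler_wpM2l//.
apply: le_trans (H _ _) _; rewrite -mulrA ler_wpM2l// -scalerBr normrZ ger0_norm//.
by rewrite !sub0r opprK addrC distrC.
Qed.

Lemma cutoff_supported n y : n.+1%:R <= `|y| -> cutoff n y = 0.
Proof.
move=> ny; rewrite /cutoff /bump3 tens_out ?mulr0//; try exact: bump_out.
by rewrite normrZ sub0r normrN ger0_norm// -ler_pdivrMl ?invr_gt0// invrK mulr1.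
Qed.

Lemma cutoff_cvg y : (fun n => cutoff n y) @ \oo --> (1 : R).
Proof.
have [K K0 H] := bump3_lipschitz.
have E0 : (16 / 15) ^+ 3 * bump3 (0 : T3) = 1 :> R.
  by rewrite /bump3 /tens /= /bump hat_in ?normr0// expr0n /= subr0; field.
apply/cvgrPdist_le => e e0; near=> n.
rewrite -E0 /cutoff -mulrBr normrM ger0_norm//.
apply: (@le_trans _ _ ((16/15)^+3 * (K * `|y|) * n.+1%:R^-1)).
  rewrite -[leRHS]mulrA ler_wpM2l//; apply: le_trans (H _ _) _.
  by rewrite !sub0r normrN normrZ normrN ger0_norm// [_^-1 * _]mulrC mulrA.
rewrite ler_pdivrMr// -ler_pdivrMl//.
apply: (@le_trans _ _ n%:R); last by rewrite ler_nat.
near: n; exact: nbhs_infty_ger.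
Unshelve. all: by end_near. Qed.

(** Approximate the indicator by a Lipschitz [f] in the L^1 norm weighted by a
    cutoff, then multiply [f] by that cutoff. *)
Lemma lipschitz_density (A : set T3) (d : R) : measurable A ->
  mu.-integrable setT (EFin \o (\1_A : T3 -> R)) -> 0 < d ->
  exists psi K L, [/\ mu.-integrable setT (EFin \o psi), forall y, 0 <= psi y <= 1,
    (forall x y, `|psi x - psi y| <= K * `|x - y|), (forall y, L <= `|y| -> psi y = 0) &
    \int[mu]_y `|\1_A y - psi y| <= d].
Proof.
move=> mA iA d0; have d2 : 0 < d / 2 by rewrite divr_gt0.
have A0 y : 0 <= (\1_A y : R) by have /andP[] := @ind01 R A y.
have m1 n : measurable_fun setT (fun y => 1 - cutoff n y).
  by apply: measurable_funB => //; exact: measurable_cutoff.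
have b1 n y : `|1 - cutoff n y| <= 1.
  exact/onem01_le1/cutoff01.
have c1 y : (fun n => 1 - cutoff n y) @ \oo --> (0 : R).
  by rewrite -[X in _ --> X](subrr 1); apply: cvgB; [exact: cvg_cst|exact: cutoff_cvg].
have [n hn] := dominated_integral_small iA A0 m1 b1 c1 d2.
have t0 y : 0 <= cutoff n y by have /andP[] := cutoff01 n y.
have [_ /(_ _ d2)[f [mf f01 [K lf] ef]]] := lip_approximable_measurable (integrable_cutoff n) t0 mA.
have [H lH] := cutoff_lipschitz n.
have fb y : `|f y| <= 1 by have /andP[a b] := f01 y; rewrite ger0_norm.
have ipsi : mu.-integrable setT (EFin \o (fun y => cutoff n y * f y)).
  exact: (integrable_mul_bounded (integrable_cutoff n) mf fb).
exists (fun y => cutoff n y * f y), (H + K), n.+1%:R; split => //.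
- move=> y; have /andP[a b] := f01 y; have /andP[a' b'] := cutoff01 n y.
  by have := ler_pM a' a b' b; rewrite mulr1 mulr_ge0.
- move=> x y.
  have -> : cutoff n x * f x - cutoff n y * f y =
     (cutoff n x - cutoff n y) * f x + cutoff n y * (f x - f y) by ring.
  apply: le_trans (ler_normD _ _) _; rewrite [leRHS]mulrDl (normrM (cutoff n x - cutoff n y)) (normrM (cutoff n y)).
  apply: lerD; first by apply: le_trans (lH x y); rewrite ler_piMr.
  apply: le_trans (lf x y); rewrite ler_piMl// ger0_norm//.
  by have /andP[] := cutoff01 n y.
- by move=> y /cutoff_supported ->; rewrite mul0r.
- have i1 : mu.-integrable setT (EFin \o (fun y => \1_A y * `|1 - cutoff n y|)).
    apply: (integrable_mul_bounded iA (C := 1)); first by apply: measurableT_comp (m1 n).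
    by move=> y; rewrite normr_id.
  have i2 : mu.-integrable setT (EFin \o (fun y => cutoff n y * `|\1_A y - f y|)).
    apply: (integrable_mul_bounded (integrable_cutoff n) (C := 1)).
      by apply: measurableT_comp => //; apply: measurable_funB => //; exact: measurable_indic.
    by move=> y; rewrite normr_id dist01_le1// ind01.
  apply: (@le_trans _ _ (\int[mu]_y (\1_A y * `|1 - cutoff n y| + cutoff n y * `|\1_A y - f y|))).
    apply: le_Rintegral => //.
    + by apply: integrable_normr; exact: integrable_subr.
    + exact: integrable_addr.
    + move=> y _; have -> : \1_A y - cutoff n y * f y =
        \1_A y * (1 - cutoff n y) + cutoff n y * (\1_A y - f y) :> R by ring.
      apply: le_trans (ler_normD _ _) _; rewrite (normrM (\1_A y)) (normrM (cutoff n y)).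
      by rewrite (ger0_norm (A0 y)) (ger0_norm (t0 y)).
  by rewrite RintegralD//; move: ef hn; clear; lra.
Qed.

(** The mollifier has mass 1 and lives at distance 1/l. *)
Lemma convol_moll_near psi K l x : mu.-integrable setT (EFin \o psi) ->
  (forall y, `|psi y| <= 1) ->
  (forall x y, `|psi x - psi y| <= K * `|x - y|) -> 0 < l ->
  `|convol psi (moll l) x - psi x| <= K / l.
Proof.
move=> ipsi b1 lpsi l0.
have K0 : 0 <= K.
  have := lpsi (1, 0, 0) 0; rewrite subr0 => /(le_trans (normr_ge0 _)).
  by rewrite pmulr_lge0// normr_gt0; apply/eqP => -[] /eqP; rewrite oner_eq0.
have mpsi : measurable_fun setT psi by move/integrableP : ipsi => [/measurable_EFinP].
have [ik ek] := integral_bump3 x l0.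
have im : mu.-integrable setT (EFin \o (fun y => moll l (x - y))) by exact: integrable_mulrl.
have em : \int[mu]_y moll l (x - y) = 1.
  by rewrite /moll RintegralZl// ek mulfV// expf_neq0// lt0r_neq0.
have ipm : mu.-integrable setT (EFin \o (fun y => psi y * moll l (x - y))).
  exact: (integrable_mul_bounded ipsi (measurable_translate_reflect x (measurable_moll l))
    (fun y => moll_le (x - y) (ltW l0))).
have -> : psi x = \int[mu]_y (psi x * moll l (x - y)) by rewrite RintegralZl// em mulr1.
have ipx : mu.-integrable setT (EFin \o (fun y => psi x * moll l (x - y))) by exact: integrable_mulrl.
rewrite /convol -RintegralB//.
have idf := integrable_subr ipm ipx.
apply: le_trans (le_normr_Rintegral measurableT idf) _.
apply: (@le_trans _ _ (\int[mu]_y (K / l * moll l (x - y)))); last by rewrite RintegralZl// em mulr1.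
apply: le_Rintegral => //; first exact: integrable_normr.
  exact: integrable_mulrl.
move=> y _; rewrite -mulrBl normrM (@ger0_norm _ (moll l _)) ?moll_ge0 ?(ltW l0)//.
have [h|h] := leP 1 `|l *: (x - y)|.
  by rewrite /moll /bump3 tens_out ?mulr0//; exact: bump_out.
rewrite ler_wpM2r ?moll_ge0 ?(ltW l0)//; apply: le_trans (lpsi y x) _.
rewrite ler_wpM2l//; move: h; rewrite normrZ gtr0_norm// -ltr_pdivlMl// mulr1 distrC.
exact: ltW.
Qed.

Lemma ae_eq_ext (u v : T3 -> R) (f g : T3 -> \bar R) :
  {ae mu, forall x, u x = v x} -> (forall x, u x = v x -> f x = g x) ->
  ae_eq mu setT f g.
Proof.
move=> [N [mN N0 sN]] fg; exists N; split => // x /= h.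
by apply: (sN) => /= uv; apply: h => _; exact: fg.
Qed.

(** Let the scale tend to infinity in [overlap_le], for a [psi] that is [d]-close
    to the indicator in L^1, then let [d] tend to 0.  The function [u] carries
    the total variation and agrees with the indicator almost everywhere. *)
Lemma mass_le (A : set T3) (u : T3 -> R) (P a : R) : measurable A ->
  mu.-integrable setT (EFin \o (\1_A : T3 -> R)) ->
  mu.-integrable setT (EFin \o u) -> {ae mu, forall x, u x = \1_A x} ->
  (total_variation3 u <= P%:E)%E -> 0 < a ->
  \int[mu]_x (\1_A x : R) <=
    \int[mu]_x (\1_A x * convol \1_A (moll a) x) + P * (19 / 100) / a.
Proof.
move=> mA iA iu uA tvu a0.
pose chi : T3 -> R := \1_A; rewrite -/chi.
have chi01 y : 0 <= chi y <= 1 by exact: ind01.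
have chi0 y : 0 <= chi y by have /andP[] := chi01 y.
have chib y : `|chi y| <= 1 by have /andP[] := chi01 y; rewrite ger0_norm.
set m := \int[mu]_x chi x; set Q := \int[mu]_x (chi x * convol chi (moll a) x).
set PP := P * (19/100) / a.
have m0 : 0 <= m by exact: Rintegral_ge0.
have nm : \int[mu]_x `|chi x| = m.
  by apply: eq_Rintegral => x _; rewrite ger0_norm.
have sqchi y : chi y * chi y = chi y.
  by rewrite /chi indicE; case: (y \in A) => /=; ring.
have mchi : measurable_fun setT chi by exact: measurable_indic.
have step (d b : R) : 0 < d -> a <= b -> exists2 K : R, 0 <= K &
   forall b, a <= b -> m - d - K / b * m <= Q + m * (d * a ^+ 3) + PP.
  move=> d0 _.
  have [psi [K [L [ipsi psi01 lpsi psiL ed]]]] := lipschitz_density mA iA d0.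
  rewrite -/chi in ed.
  have pb y : `|psi y| <= 1 by have /andP[p q] := psi01 y; rewrite ger0_norm.
  have mpsi : measurable_fun setT psi by move/integrableP : ipsi => [/measurable_EFinP].
  have psi0 y : 0 <= psi y by have /andP[] := psi01 y.
  have K0 : 0 <= K.
    have := lpsi (1, 0, 0) 0; rewrite subr0 => /(le_trans (normr_ge0 _)).
    by rewrite pmulr_lge0// normr_gt0; apply/eqP => -[] /eqP; rewrite oner_eq0.
  exists K => // c ac; have c0 : 0 < c by exact: lt_le_trans ac.
  have ou l : 0 < l -> overlap psi u l = overlap psi chi l.
    move=> l0; congr fine; apply: ae_eq_integral => //.
    - by have /integrableP[] := integrable_overlap psi01 ipsi iu l0.
    - by have /integrableP[] := integrable_overlap psi01 ipsi iA l0.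
    - by apply: (ae_eq_ext uA) => x ux; rewrite ux.
  have H := overlap_le psi01 ipsi psiL iu tvu a0 ac.
  rewrite !ou// in H.
  have icp : mu.-integrable setT (EFin \o (fun x => chi x * psi x)).
    exact: (integrable_mul_bounded iA mpsi pb).
  have io l : 0 < l -> mu.-integrable setT (EFin \o (fun x => chi x * convol psi (moll l) x)).
    by move=> l0; exact: (integrable_overlap psi01 ipsi iA l0).
  have ic l : 0 < l -> mu.-integrable setT (EFin \o (fun x => chi x * convol chi (moll l) x)).
    by move=> l0; exact: (integrable_overlap chi01 iA iA l0).
  (* At the fine scale c the overlap is close to the mass. *)
  have H1 : `|overlap psi chi c - \int[mu]_x (chi x * psi x)| <= K / c * m.
    rewrite /overlap -RintegralB//; last exact: io.
    under eq_Rintegral do rewrite -mulrBr.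
    rewrite -nm; apply: (le_norm_int_mul iA) => [|x]; last exact: convol_moll_near.
    apply: measurable_funB => //.
    exact: (measurable_convol psi0 ipsi (measurable_moll c) (fun z => moll_le z (ltW c0))).
  have H2 : m - d <= \int[mu]_x (chi x * psi x).
    have idf : mu.-integrable setT (EFin \o (fun x => `|chi x - psi x|)).
      by apply: integrable_normr; exact: integrable_subr.
    apply: (@le_trans _ _ (m - \int[mu]_x `|chi x - psi x|)); first by rewrite lerD2l lerN2.
    rewrite /m -RintegralB//; apply: le_Rintegral => //; first exact: integrable_subr.
    move=> x _; rewrite lerBlDr -lerBlDl -{1}(sqchi x) -mulrBr.
    apply: le_trans (ler_norm _) _; rewrite normrM ler_piMl//.
  (* At the coarse scale a, psi is replaced by the indicator; moll a <= a^3. *)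
  have H3 : overlap psi chi a <= Q + m * (d * a ^+ 3).
    have -> : m * (d * a ^+ 3) = \int[mu]_x (d * a ^+ 3 * chi x) by rewrite RintegralZl// mulrC.
    rewrite /Q /overlap -RintegralD//; [|exact: ic|exact: integrable_mulrl].
    apply: le_Rintegral => //; first exact: io.
      by apply: integrable_addr; [exact: ic|exact: integrable_mulrl].
    move=> x _; rewrite [d * _ * _]mulrC -mulrDr ler_wpM2l// -lerBlDl.
    have mm := measurable_translate_reflect x (measurable_moll a).
    have bm y := moll_le (x - y) (ltW a0).
    rewrite /convol -RintegralB//; first last.
    - exact: (integrable_mul_bounded iA mm bm).
    - exact: (integrable_mul_bounded ipsi mm bm).
    under eq_Rintegral do rewrite -mulrBl.
    apply: le_trans (ler_norm _) _.
    have idf := integrable_subr ipsi iA.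
    have := le_norm_int_mul idf mm bm; move/le_trans; apply.
    rewrite mulrC ler_wpM2r ?exprn_ge0// ?(ltW a0)//; apply: le_trans ed.
    by under eq_Rintegral do rewrite distrC.
  move: H H1 H2 H3; rewrite -/PP ler_norml.
  move: (overlap _ _ c) (overlap _ _ a) (\int[mu]_x (chi x * psi x)) (K / c * m) (m * (d * a ^+ 3)).
  by move=> ov ow s t r h /andP[h1 h2] h3 h4; move: h h1 h2 h3 h4; clear; lra.
apply/ler_addgt0Pr => e e0.
pose d := e / 2 / (1 + m * a ^+ 3).
have D0 : 0 < 1 + m * a ^+ 3 by rewrite ltr_pwDl// mulr_ge0// exprn_ge0// ltW.
have d0 : 0 < d by rewrite divr_gt0// divr_gt0.
have [K K0 HK] := step d a d0 (lexx a).
(* With this scale the term K / b * m is at most e / 2. *)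
pose b := a + K * m / (e / 2).
have e2 : 0 < e / 2 by rewrite divr_gt0.
have b0 : 0 <= K * m / (e / 2) by apply: divr_ge0; [exact: mulr_ge0|exact: ltW].
have ab : a <= b by rewrite lerDl.
have bb : 0 < b by exact: lt_le_trans ab.
have := HK b ab.
have h1 : K / b * m <= e / 2.
  rewrite mulrAC ler_pdivrMr// /b mulrDr mulrCA mulfV ?mulr1 ?lt0r_neq0 ?divr_gt0//.
  by rewrite lerDr mulr_ge0// ltW// divr_gt0.
have h2 : d + m * (d * a ^+ 3) = e / 2.
  by rewrite /d; field; exact: lt0r_neq0.
move: h1 h2; move: (K / b * m) (m * (d * a ^+ 3)) => s t; clear; lra.
Qed.
End mass_bound.

(** * Numerical bounds and comparison with the Coulomb kernel *)

Section numerics.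
Context {R : realType}.

Lemma sin_MVT (x : R) : 0 < x -> exists2 c, 0 < c < x & sin x = cos c * x.
Proof.
move=> x0; have [c] := @MVT R sin cos 0 x x0 (fun y _ => is_derive_sin y)
  (continuous_subspaceT (@continuous_sin R)).
by rewrite in_itv/= sin0 !subr0 => cx ->; exists c.
Qed.

Lemma sin_le_id (x : R) : 0 < x -> `|sin x| <= x.
Proof.
move=> x0; have [c _ ->] := sin_MVT x0.
by rewrite normrM (gtr0_norm x0) ler_piMl ?(ltW x0)// cos_max.
Qed.

Lemma cos_mul2 (x : R) : cos (x *+ 2) = 1 - 2 * sin x ^+ 2.
Proof. by rewrite cos_mulr2n cos2sin2; ring. Qed.

Lemma cos_ge_parabola (x : R) : 0 < x -> 1 - x ^+ 2 / 2 <= cos x.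
Proof.
move=> x0; have -> : x = (x / 2) *+ 2 by rewrite -mulr_natr divfK.
rewrite cos_mul2; have h0 : 0 < x / 2 by lra.
have h : sin (x / 2) ^+ 2 <= (x / 2) ^+ 2.
  by rewrite -(real_normK (num_real (sin _))) ler_sqr ?nnegrE ?(ltW h0)// sin_le_id.
have -> : ((x / 2) *+ 2) ^+ 2 = 4 * (x / 2) ^+ 2 by rewrite -mulr_natr; ring.
move: (sin _ ^+ 2) ((x/2) ^+ 2) h => *; lra.
Qed.

(** If pi/2 were larger than 17/10, then cos (17/10) would be positive; but two
    angle doublings starting from sin (17/40) >= 154/400 make it negative. *)
Lemma pi_le_17_5 : pi <= 17 / 5 :> R.
Proof.
rewrite leNgt; apply/negP => pi_big.
have h1 : 0 < cos (17 / 10 : R) by apply: cos_gt0_pihalf; apply/andP; split; lra.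
have s0 : 0 < 17 / 40 :> R by lra.
have [c /andP[c0 c1] sE] := sin_MVT s0.
have sb : 154 / 400 <= sin (17 / 40 : R).
  rewrite sE; have := cos_ge_parabola c0 => h.
  have : c ^+ 2 <= (17 / 40) ^+ 2 by rewrite ler_sqr ?nnegrE ?ltW.
  rewrite (expr2 (17 / 40)); move: (c ^+ 2) (cos c) h => p q h h'; lra.
have sqM (a b : R) : 0 <= a -> a <= b -> a ^+ 2 <= b ^+ 2.
  by move=> a0 ab; rewrite ler_sqr ?nnegrE// (le_trans a0).
have sb2 : 2 * sin (17 / 40 : R) ^+ 2 >= 2 * (154 / 400) ^+ 2.
  rewrite ler_pM2l//; apply: sqM sb; lra.
have e1 : (17 / 20 : R) = (17 / 40) *+ 2 by rewrite -mulr_natr; field.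
have e2 : (17 / 10 : R) = (17 / 20) *+ 2 by rewrite -mulr_natr; field.
have c2 : cos (17 / 20 : R) <= 1 - 2 * (154 / 400) ^+ 2 by rewrite e1 cos_mul2; lra.
have c3 : 0 <= cos (17 / 20 : R).
  by have := @cos_ge_parabola (17/20) ltac:(lra); apply: le_trans; rewrite expr2; lra.
have : cos (17 / 20 : R) ^+ 2 <= (1 - 2 * (154 / 400) ^+ 2) ^+ 2.
  exact: sqM.
move: h1; rewrite e2 cos_mulr2n -mulr_natr => h1 h2.
have : (1 - 2 * (154 / 400 : R) ^+ 2) ^+ 2 < 1 / 2 by rewrite !expr2; clear; lra.
move: (cos _ ^+ 2) h1 h2; clear => q h1 h2; lra.
Qed.

Lemma expR1_ge : (9 / 8) ^+ 8 <= expR 1 :> R.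
Proof.
have -> : (1 : R) = 8%:R * (1 / 8) by field.
rewrite expRM_natl ler_pXn2r ?nnegrE ?expR_ge0//.
by apply: le_trans (expR_ge1Dx _); lra.
Qed.

(** Compare cubes: 3^5 = 243 and 4 * 157/100 = 6.28 with 6.28^3 > 247. *)
Lemma target_constant_le : (3 : R) `^ (5 / 3) / 4 <= 157 / 100.
Proof.
rewrite ler_pdivrMr//; set x := _ `^ _.
have x0 : 0 <= x by exact: powR_ge0.
have x3 : x ^+ 3 = 243.
  rewrite /x -powR_mulrn// -powRrM.
  have -> : (5 / 3 * 3%:R : R) = 5%:R by field.
  by rewrite powR_mulrn//; ring.
have y0 : 0 <= 157 / 100 * 4 :> R by clear; lra.
rewrite -(ler_pXn2r (isT : (0 < 3)%N) x0 y0) x3 !exprS expr0; clear; lra.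
Qed.

Local Notation T3 := (R * R * R)%type.
Implicit Types z w : T3.

Lemma hat_le_expR (u : R) : hat u <= expR (- u ^+ 2).
Proof. by rewrite /hat ge_max expR_ge0/= expR_ge1Dx. Qed.

(** With r = |w|^2, the product of the three factors max(0, 1 - w_i^2) is at
    most exp(-r), and 4 r exp(-4 r) <= 1/e because x <= exp(x - 1). *)
Lemma bump3_sq_le w : dot3 w w * bump3 w ^+ 2 <= (26 / 100) ^+ 2.
Proof.
set r := dot3 w w; have r0 : 0 <= r by exact: dot3_ge0.
pose h := hat w.1.1 * hat w.1.2 * hat w.2.
have h0 : 0 <= h by rewrite !mulr_ge0// hat_ge0.
have hr : h <= expR (- r).
  have -> : - r = - w.1.1 ^+ 2 + - w.1.2 ^+ 2 + - w.2 ^+ 2 by rewrite /r /dot3; ring.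
  rewrite !expRD; apply: ler_pM; rewrite ?mulr_ge0 ?hat_ge0 ?hat_le_expR//.
  by apply: ler_pM; rewrite ?hat_ge0 ?hat_le_expR.
have -> : bump3 w ^+ 2 = (15 / 16) ^+ 6 * h ^+ 4 by rewrite /bump3 /tens /bump /h; ring.
have h4 : h ^+ 4 <= expR (- (4 * r)).
  by rewrite -mulrN expRM_natl lerXn2r ?nnegrE ?expR_ge0.
have H : 4 * r * expR (- (4 * r)) <= (expR 1)^-1.
  rewrite expRN ler_pdivrMr ?expR_gt0// -expRN -expRD.
  by apply: le_trans (expR_ge1Dx _); lra.
have e1 : (expR 1)^-1 <= (8 / 9) ^+ 8 :> R.
  by rewrite -[leRHS]invrK lef_pV2 ?posrE ?expR_gt0 -?exprVn ?invf_div ?expR1_ge// exprn_gt0.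
have H2 : r * h ^+ 4 <= (8 / 9) ^+ 8 / 4.
  have : r * h ^+ 4 <= r * expR (- (4 * r)) by rewrite ler_wpM2l.
  move: H e1; rewrite -mulrA; move: (r * h ^+ 4) (r * expR _) ((expR 1)^-1) ((8/9) ^+ 8) => *; lra.
rewrite mulrCA; apply: (@le_trans _ _ ((15 / 16) ^+ 6 * ((8 / 9) ^+ 8 / 4))).
  by rewrite ler_wpM2l.
by rewrite !exprS !expr0; lra.
Qed.

Lemma enorm3_bump3_le w : enorm3 w * bump3 w <= 26 / 100.
Proof.
have a0 : 0 <= enorm3 w * bump3 w by apply: mulr_ge0; [exact: sqrtr_ge0|exact: bump3_ge0].
have b0 : 0 <= 26 / 100 :> R by lra.
rewrite -(ler_sqr a0 b0).
by rewrite exprMn /enorm3 sqr_sqrtr ?dot3_ge0// bump3_sq_le.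
Qed.

Lemma enorm3_scale (l : R) w : 0 <= l -> enorm3 (l *: w) = l * enorm3 w.
Proof.
move=> l0; rewrite /enorm3; have -> : dot3 (l *: w) (l *: w) = l ^+ 2 * dot3 w w.
  by rewrite /dot3 /= /GRing.scale/=; ring.
by rewrite sqrtrM ?sqr_ge0// sqrtr_sqr ger0_norm.
Qed.

(** At distance [enorm3 z] the claim reads
    157/100 * (3/10)^2 * 8 pi * (|w| k(w)) <= 1 with w = (3/10) z; the factors
    26/100 and 17/5 make the left-hand side 0.9993. *)
Lemma moll_le_coulomb z : z != 0 ->
  157 / 100 * moll (3 / 10) z <= (8 * pi)^-1 * (enorm3 z)^-1.
Proof.
move=> z0; have n0 : 0 < enorm3 z.
  rewrite sqrtr_gt0 lt_neqAle dot3_ge0 andbT eq_sym; apply: contra z0.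
  rewrite /dot3 -!expr2 => /eqP h.
  have := sqr_ge0 z.1.1; have := sqr_ge0 z.1.2; have := sqr_ge0 z.2 => h1 h2 h3.
  have a : z.1.1 ^+ 2 = 0 by lra.
  have b : z.1.2 ^+ 2 = 0 by lra.
  have c : z.2 ^+ 2 = 0 by lra.
  move: a b c => /eqP; rewrite sqrf_eq0 => /eqP a /eqP; rewrite sqrf_eq0 => /eqP b /eqP.
  by rewrite sqrf_eq0 => /eqP c; case: z a b c {h h1 h2 h3} => -[? ?] ? /= -> -> ->.
rewrite -invfM -[leRHS]div1r.
rewrite (ler_pdivlMr _ _ (mulr_gt0 (mulr_gt0 (ltr0Sn _ 7) (pi_gt0 R)) n0)).
have l0 : 0 <= 3 / 10 :> R by lra.
have := enorm3_bump3_le ((3 / 10) *: z); rewrite (enorm3_scale _ l0).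
rewrite /moll => h.
have -> : 157 / 100 * ((3 / 10) ^+ 3 * bump3 ((3 / 10) *: z)) * (8 * pi * enorm3 z) =
  pi * ((157 / 100 * (3/10)^+2 * 8) * (3 / 10 * enorm3 z * bump3 ((3 / 10) *: z))) by ring.
apply: (@le_trans _ _ (pi * (157 / 100 * (3/10)^+2 * 8 * (26/100)))).
  have k0 : 0 <= 157 / 100 * (3 / 10) ^+ 2 * 8 :> R by rewrite expr2; clear; lra.
  exact: (ler_wpM2l (pi_ge0 R) (ler_wpM2l k0 h)).
move: pi_le_17_5; rewrite expr2; clear; lra.
Qed.
End numerics.

(** * The Coulomb energy and the lower bound *)

Section coulomb.
Context {R : realType}.
Local Notation T3 := (R * R * R)%type.
Local Notation mu := (@lebesgue3 R).

(** Tonelli's measurability statement for a function of variable sign, by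
    splitting it into positive and negative parts. *)
Lemma measurable_fun_integral_section d1 d2 (T1 : measurableType d1) (T2 : measurableType d2)
    (m2 : {sigma_finite_measure set T2 -> \bar R}) (f : T1 * T2 -> \bar R) :
  measurable_fun setT f -> measurable_fun setT (fun x => \int[m2]_y f (x, y))%E.
Proof.
move=> mf.
have -> : (fun x => \int[m2]_y f (x, y))%E =
  (fun x => fubini_F m2 (f^\+) x - fubini_F m2 (f^\-) x)%E.
  apply/funext => x; rewrite /fubini_F [LHS]integralE.
  under eq_integral do rewrite funepos_comp/=.
  by under [X in (_ - X)%E = _]eq_integral do rewrite funeneg_comp/=.
apply: emeasurable_funB; apply: measurable_fun_fubini_tonelli_F => //.
- exact: measurable_funepos.
- exact: measurable_funeneg.
Qed.

Definition coulomb_kernel (u v : T3 -> R) (p : T3 * T3) : \bar R :=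
  (u p.1 * v p.2 / enorm3 (p.1 - p.2))%:E.

(** The inverse norm is a composition of real powers, which are measurable
    everywhere, the origin included. *)
Lemma measurable_inv_enorm3 : measurable_fun setT (fun z : T3 => (enorm3 z)^-1).
Proof.
have -> : (fun z : T3 => (enorm3 z)^-1) = (fun z => (dot3 z z `^ 2^-1) `^ (-1)).
  by apply/funext => z; rewrite powR12_sqrt ?dot3_ge0// powR_inv1// sqrtr_ge0.
apply: (measurableT_comp (measurable_powR _)).
apply: (measurableT_comp (measurable_powR _)).
have M (p : T3 -> R) : measurable_fun setT p -> measurable_fun setT (fun z => p z * p z).
  by move=> mp; exact: measurable_funM.
exact: (measurable_funD (measurable_funD (M _ (@measurable_x1 R)) (M _ (@measurable_x2 R)))
  (M _ (@measurable_x3 R))).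
Qed.

Lemma measurable_coulomb_kernel u v : measurable_fun setT u -> measurable_fun setT v ->
  measurable_fun setT (coulomb_kernel u v).
Proof.
move=> m_u mv; apply/measurable_EFinP; apply: measurable_funM; first apply: measurable_funM.
- exact: measurableT_comp m_u measurable_fst.
- exact: measurableT_comp mv measurable_snd.
- exact: measurableT_comp measurable_inv_enorm3 measurable_sub3.
Qed.

Lemma coulombE u : coulomb u = (\int[mu]_x \int[mu]_y coulomb_kernel u u (x, y))%E.
Proof. by []. Qed.

Lemma section_measurable (f : T3 * T3 -> \bar R) x : measurable_fun setT f ->
  measurable_fun setT (fun y => f (x, y)).
Proof.
move=> mf; apply: measurableT_comp mf _; exact: pair1_measurable.
Qed.

(** Both iterated integrals see their function only almost everywhere. *)
Lemma coulomb_ae (u v : T3 -> R) : measurable_fun setT u -> measurable_fun setT v ->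
  {ae mu, forall x, u x = v x} -> coulomb u = coulomb v.
Proof.
move=> m_u mv uv; rewrite !coulombE.
have muu := measurable_coulomb_kernel m_u m_u.
have mvv := measurable_coulomb_kernel mv mv.
apply: ae_eq_integral; first exact: measurableT.
- exact: (measurable_fun_integral_section mu muu).
- exact: (measurable_fun_integral_section mu mvv).
apply: (ae_eq_ext uv) => x ux; apply: ae_eq_integral; first exact: measurableT.
- exact: section_measurable muu.
- exact: section_measurable mvv.
by apply: (ae_eq_ext uv) => y uy; rewrite /coulomb_kernel /= ux uy.
Qed.

Lemma lebesgue3_set1 (x : T3) : measurable [set x] /\ mu [set x] = 0%E.
Proof.
have -> : [set x] = ([set x.1.1] `*` [set x.1.2]) `*` [set x.2].
  apply/seteqP; split => [y ->|y /= [[a b] c]]; first by [].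
  by case: x a b c => -[? ?] ?; case: y => -[? ?] ? /= -> -> ->.
have m12 : measurable ([set x.1.1] `*` [set x.1.2]) by exact: measurableX.
split; first exact: measurableX.
by rewrite /lebesgue3 product_measure1E// [X in (_ * X)%E]lebesgue_measure_set1 mule0.
Qed.

(** [moll_le_coulomb] integrated twice.  It fails on the diagonal, where the
    kernel has the value 0, so the inner comparison holds off the null set
    [[set x]] only. *)
Lemma overlap_le_coulomb (A : set T3) : measurable A ->
  mu.-integrable setT (EFin \o (\1_A : T3 -> R)) ->
  ((157 / 100 * \int[mu]_x (\1_A x * convol \1_A (moll (3 / 10)) x))%:E <=
   ((8 * pi)^-1)%:E * coulomb (\1_A : T3 -> R))%E.
Proof.
move=> mA iA; pose chi : T3 -> R := \1_A; rewrite -/chi.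
have l0 : 0 < 3 / 10 :> R by lra.
have chi01 y : 0 <= chi y <= 1 by exact: ind01.
have chi0 y : 0 <= chi y by have /andP[] := chi01 y.
have mchi : measurable_fun setT chi by exact: measurable_indic.
have c0 : 0 <= (8 * pi)^-1 :> R by rewrite invr_ge0 mulr_ge0// pi_ge0.
have iQ := integrable_overlap chi01 iA iA l0.
pose f1 p := (157 / 100 * (chi p.1 * (chi p.2 * moll (3 / 10) (p.1 - p.2))))%:E : \bar R.
pose f2 p := (((8 * pi)^-1)%:E * coulomb_kernel chi chi p)%E.
have m1 : measurable_fun setT f1.
  apply/measurable_EFinP; apply: measurable_funM => //; apply: measurable_funM.
    exact: measurableT_comp mchi measurable_fst.
  apply: measurable_funM; first exact: measurableT_comp mchi measurable_snd.
  exact: measurableT_comp (measurable_moll _) measurable_sub3.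
have mk := measurable_coulomb_kernel mchi mchi.
have m2 : measurable_fun setT f2 by exact: measurable_funeM.
have k0 p : (0 <= coulomb_kernel chi chi p)%E.
  by rewrite lee_fin divr_ge0 ?sqrtr_ge0// mulr_ge0.
have Z (g : T3 -> \bar R) : measurable_fun setT g -> (forall x, 0 <= g x)%E ->
    (\int[mu]_x (((8 * pi)^-1)%:E * g x) = ((8 * pi)^-1)%:E * \int[mu]_x g x)%E.
  by move=> mg g0; rewrite ge0_integralZl.
have f10 p : (0 <= f1 p)%E.
  rewrite lee_fin; apply: mulr_ge0; first by rewrite divr_ge0.
  exact: mulr_ge0 (chi0 _) (mulr_ge0 (chi0 _) (moll_ge0 _ (ltW l0))).
have f20 p : (0 <= f2 p)%E by rewrite mule_ge0// lee_fin.
have E1 : ((157 / 100 * \int[mu]_x (chi x * convol chi (moll (3 / 10)) x))%:E =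
    \int[mu]_x \int[mu]_y f1 (x, y))%E.
  rewrite -RintegralZl// /Rintegral fineK; last first.
    exact: (integrable_fin_num measurableT (integrable_mulrl (157/100) iQ)).
  apply: eq_integral => x _; rewrite /f1 /=.
  have ip : mu.-integrable setT (EFin \o (fun y => chi y * moll (3 / 10) (x - y))).
    exact: (integrable_mul_bounded iA (measurable_translate_reflect x (measurable_moll _))
      (fun y => moll_le (x - y) (ltW l0))).
  rewrite mulrA /convol EFinM /Rintegral fineK; last exact: (integrable_fin_num measurableT ip).
  rewrite -integralZl//; apply: eq_integral => y _; rewrite -EFinM; congr EFin; ring.
have E2 : (((8 * pi)^-1)%:E * coulomb chi = \int[mu]_x \int[mu]_y f2 (x, y))%E.
  rewrite coulombE -(Z _ (measurable_fun_integral_section mu mk)); last first.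
    by move=> x; apply: integral_ge0.
  apply: eq_integral => x _; rewrite -(Z _ (section_measurable x mk)) => [//|y].
  exact: k0.
rewrite E1 E2; apply: ge0_le_integral.
- exact: measurableT.
- by move=> x _; apply: integral_ge0.
- exact: (measurable_fun_integral_section mu m1).
- exact: (measurable_fun_integral_section mu m2).
move=> x _; apply: ae_ge0_le_integral.
- exact: measurableT.
- by move=> y _; exact: f10.
- exact: section_measurable m1.
- by move=> y _; exact: f20.
- exact: section_measurable m2.
have [ms s0] := lebesgue3_set1 x.
exists [set x]; split => // y /= h; apply: contrapT => yx; apply: h => _.
rewrite /f1 /f2 /coulomb_kernel /= -EFinM lee_fin.
have xy : x - y != 0 by rewrite subr_eq0; apply/eqP => e; apply: yx.
have cc : 0 <= chi x * chi y by exact: mulr_ge0.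
have := ler_wpM2l cc (moll_le_coulomb xy).
congr (_ <= _); ring.
Qed.

End coulomb.

(** It remains to replace the given function by the indicator of the set where
    it equals 1, and to combine the two estimates at the scale 3/10. *)
Theorem theorem2p2 (R : realType) :
  ((3 `^ (5 / 3) / 4)%:E <= fstar R)%E.
Proof.
apply: le_ereal_inf_tmp => _ [u [[[iu tvu] u01] mass0] <-].
pose mu := @lebesgue3 R.
have m_u : measurable_fun setT u by move/integrableP : iu => [/measurable_EFinP].
pose A := u @^-1` [set 1]; pose chi : R * R * R -> R := \1_A.
have mA : measurable A by rewrite -[A]setTI; exact: m_u.
have mchi : measurable_fun setT chi by exact: measurable_indic.
have uA : {ae mu, forall x, u x = chi x}.
  have [N [mN N0 sN]] := u01; exists N; split => // x /= h; apply: (sN) => /= ux; apply: h.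
  rewrite /chi indicE /A; case: ux => ux.
    by rewrite memNset//= ux => /esym/eqP; rewrite oner_eq0.
  by rewrite mem_set.
have iA : mu.-integrable setT (EFin \o chi).
  apply/integrableP; split; first exact/measurable_EFinP.
  have /integrableP[_] := iu; apply: le_lt_trans; rewrite le_eqVlt; apply/orP; left; apply/eqP.
  apply: ae_eq_integral => //.
  - by apply/measurable_EFinP; exact: measurableT_comp.
  - by apply/measurable_EFinP; exact: measurableT_comp.
  - by apply: (ae_eq_ext uA) => x ux; rewrite /= ux.
pose m := \int[mu]_x chi x.
have massE : mass u = m%:E.
  rewrite /mass /m /Rintegral fineK; last exact: (integrable_fin_num measurableT iA).
  apply: ae_eq_integral => //; [exact/measurable_EFinP|exact/measurable_EFinP|].
  by apply: (ae_eq_ext uA) => x ux; rewrite ux.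
have m0 : 0 < m by rewrite -lte_fin -massE.
have tvfin : total_variation3 u \is a fin_num by rewrite ge0_fin_numE// total_variation3_ge0.
pose P := fine (total_variation3 u).
have tvE : total_variation3 u = P%:E by rewrite fineK.
have P0 : 0 <= P by rewrite -lee_fin -tvE total_variation3_ge0.
have l0 : 0 < 3 / 10 :> R by lra.
have tvP : (total_variation3 u <= P%:E)%E by rewrite tvE.
pose Q := \int[mu]_x (chi x * convol chi (moll (3 / 10)) x).
have HQ : ((157 / 100 * Q)%:E <= ((8 * pi)^-1)%:E * coulomb chi)%E :=
  overlap_le_coulomb mA iA.
have Hm : m <= Q + P * (19 / 100) / (3 / 10) := mass_le mA iA iu uA tvP l0.
rewrite /energy massE inver gt_eqF// lee_pdivlMr// tvE (coulomb_ae m_u mchi uA).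
apply: le_trans (leeD2l _ HQ); rewrite -EFinM -EFinD lee_fin.
apply: (@le_trans _ _ (157 / 100 * m)); first by rewrite ler_wpM2r ?target_constant_le// ltW.
move: Hm; have -> : P * (19 / 100) / (3 / 10) = P * (19 / 30) by field.
move: m Q {m0 massE HQ} => m Q; lra.
Qed.
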